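(* Let $m>0$ and let $n\ge 1$ be an integer. Let $(Y(t),\tilde Y(t))_{t\ge 0}$, with $Y(t)=(Y_1(t),\dots,Y_n(t))\in\mathbb{Z}^n$ and $\tilde Y(t)=(\tilde Y_1(t),\dots,\tilde Y_n(t))\in\mathbb{Z}^n$, be the continuous-time Markov process on $\mathbb{Z}^n\times\mathbb{Z}^n$ with generator $$ \mathcal{L} f(y,\tilde y)=\sum_{e=\pm 1}\sum_{i=1}^n \frac m2\left[f(y^{i,i+e},\tilde y^{i,i+e})-f(y,\tilde y)\right]+\sum_{e=\pm 1}\sum_{i=1}^n\sum_{k=1}^n I(y_k=y_i+e)\left[f(y^{i,i+e},\tilde y)-f(y,\tilde y)\right], $$ where $y^{i,i+e}\in\mathbb{Z}^n$ is defined by $y^{i,i+e}_j=y_j$ for $j\ne i$ and $y^{i,i+e}_i=y_i+e$ (and similarly for $\tilde y^{i,i+e}$). Suppose that the process starts from a deterministic initial state with $Y(0)=\tilde Y(0)$. Then for every $1\le i\le n$, $$ \lim_{t\to\infty}\frac{|Y_i(t)-\tilde Y_i(t)|^2}{t}=0\quad\text{in probability.} $$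
   Context: $I(\cdot)$ denotes the indicator function. The process is a coupling: the first marginal $Y(t)$ evolves as $n$ labelled particles of the symmetric inclusion process $SIP(m)$ on $\mathbb{Z}$ (each particle jumps to each nearest-neighbor site at rate $m/2$ plus the number of particles located at the target site), and the second marginal $\tilde Y(t)$ evolves as $n$ independent continuous-time nearest-neighbor symmetric random walks on $\mathbb{Z}$, each jumping to each neighboring site at rate $m/2$. Random walk jumps are performed together by $Y_i$ and $\tilde Y_i$; inclusion jumps are performed only by the $Y$ particles. *)

(* Defs.v *)
From HB Require Import structures.
From mathcomp Require Import all_boot all_order all_algebra.
From mathcomp Require Import all_classical all_reals all_analysis.

Set Implicit Arguments.
Unset Strict Implicit.
Unset Printing Implicit Defensive.

Import Order.TTheory GRing.Theory Num.Theory.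
Import numFieldNormedType.Exports.

Local Open Scope classical_set_scope.
Local Open Scope ring_scope.

(* Processes are indexed by R; only the times t >= 0 are constrained. *)
Section Markov.
Context {R : realType} {d : measure_display} {S : measurableType d}.

Definition is_transition_semigroup (p : R -> R.-pker S ~> S) : Prop :=
  (forall (x : S) (A : set S), measurable A -> p 0 x A = \d_x A) /\
  (forall s t : R, 0 <= s -> 0 <= t ->
     forall (x : S) (A : set S), measurable A ->
       p (s + t) x A = (\int[p s x]_y p t y A)%E).

Definition transition_op (p : R -> R.-pker S ~> S) (t : R) (f : S -> R)
  (x : S) : R := \int[p t x]_y f y.

(* The operators considered below have bounded jump rates, so the domain of
   the generator is the whole space of bounded measurable functions with the
   supremum norm. *)
Definition has_generator (p : R -> R.-pker S ~> S)
    (L : (S -> R) -> S -> R) : Prop :=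
  forall f : S -> R, measurable_fun setT f -> bounded_fun f ->
    {uniform, (fun (t : R) (x : S) => (transition_op p t f x - f x) / t)
                @ 0^'+ --> L f}.

Section Process.
Context {d' : measure_display} {T : measurableType d'}.
Variable P : probability T R.

Definition natural_filtration (X : R -> {RV P >-> S}) (s : R) :
    set (set T) :=
  <<s [set A | exists u : R, 0 <= u <= s /\
         exists2 B : set S, measurable B & A = X u @^-1` B] >>.

Definition markov_property (X : R -> {RV P >-> S})
    (p : R -> R.-pker S ~> S) : Prop :=
  forall s t : R, 0 <= s -> 0 <= t ->
    forall A : set T, natural_filtration X s A ->
    forall B : set S, measurable B ->
      P (A `&` X (s + t) @^-1` B) = (\int[P]_(w in A) p t (X s w) B)%E.

Definition markov_process_with_generator (X : R -> {RV P >-> S})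
    (L : (S -> R) -> S -> R) : Prop :=
  exists p : R -> R.-pker S ~> S,
    [/\ is_transition_semigroup p, has_generator p L & markov_property X p].

Definition cvg_in_probability (Z : R -> T -> R) (l : R) : Prop :=
  forall eps : R, 0 < eps ->
    P [set w | eps <= `|Z t w - l|] @[t --> +oo] --> 0%E.

End Process.
End Markov.

Definition config (n : nat) := {ffun 'I_n -> int}.

Definition coupled_state (n : nat) := (config n * config n)%type.

HB.instance Definition _ n := Choice.on (coupled_state n).
HB.instance Definition _ n :=
  isPointed.Build (coupled_state n) ([ffun=> 0], [ffun=> 0]).
HB.instance Definition _ n := @isMeasurable.Build default_measure_display
  (coupled_state n) discrete_measurable discrete_measurable0
  discrete_measurableC discrete_measurableU.

Definition jump (n : nat) (y : config n) (i : 'I_n) (e : int) : config n :=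
  [ffun j => if j == i then y j + e else y j].

Definition coupling_generator (R : realType) (n : nat) (m : R)
    (f : coupled_state n -> R) (z : coupled_state n) : R :=
  let y := z.1 in
  let y' := z.2 in
  \sum_(e <- [:: 1; -1] : seq int) \sum_(i < n)
     m / 2 * (f (jump y i e, jump y' i e) - f (y, y'))
  + \sum_(e <- [:: 1; -1] : seq int) \sum_(i < n) \sum_(k < n)
     (y k == y i + e)%:R * (f (jump y i e, y') - f (y, y')).

(* Main.v *)
Require Import Defs.
From HB Require Import structures.
From mathcomp Require Import all_boot all_order all_algebra.
From mathcomp Require Import all_classical all_reals all_analysis.
From mathcomp Require Import measurable_realfun.
From mathcomp Require Import ring lra zify.
Import Order.TTheory GRing.Theory Num.Theory.
Import numFieldNormedType.Exports.
Local Open Scope classical_set_scope.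
Local Open Scope ring_scope.
Set Implicit Arguments.
Unset Strict Implicit.
Unset Printing Implicit Defensive.

(** Why the theorem holds.  A joint random-walk jump does not change the
displacement [y i - y' i]; an inclusion jump of particle [i] moves it one step
towards a neighbouring particle.  The drift of the displacement is therefore
the number of particles just to the right of particle [i] minus the number
just to its left.  Up to time [t] each of these counts accumulates an amount of
order [sqrt t], so it is their difference that has to be [o(sqrt t)].  The
cancellation comes from a bounded corrector: for a single pair at separation
[z], the generator maps [sgn z] to [- (m + 2)] times the difference of the
indicators of [z = 1] and [z = -1].  Adding [(m + 2)^-1] times the sum of
[sgn (y k - y i)] over the other particles [k] to the displacement thus
removes its drift, except when a third particle is close by
([corrected_gap_drift]); and the corrected displacement moves only when some
particle is close to particle [i] ([corrected_gap_variance]).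

It remains to see that, up to time [t], two particles are close during a time
[o(t)] and three particles are close during a time [o(sqrt t)].  Both are
obtained from Lyapunov functions, that is, from nonnegative bounded functions
that the generator maps to something at least the indicator of the event, up
to a small error.  A sum, over all labellings of [q] of the [n] particles, of a
function of [q] particles is mapped by the generator to the same sum built from
the [q]-particle generator ([sip_generator_consistent]), because inclusion jumps
of two particles towards each other compensate for everybody else.  Hence it is
enough to treat two and three particles in isolation.  For two, a truncation of
[|z|] has the required convexity at the origin ([pair_lyapunov]).  For three,
the relative positions perform a planar walk and the square root of the
distance is strictly subharmonic in the plane; the defects along the lines
where two particles touch are absorbed by adding a multiple of the [|z|] to the
squared distance ([triple_lyapunov]).

No integral over time is needed: if [f] is bounded and the generator maps it
below the constant [c], then the semigroup maps it below [f + t c]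
([transition_op_generator_le]).  With [s ^ 4 = t], this is applied to
[h ^ 2 / (t + h ^ 2)], where [h] is the corrected displacement, minus suitable
multiples of the two Lyapunov functions at scale [s]; the outcome is that the
displacement exceeds [sqrt (eps t)] with probability at most a constant times
[t ^ (- 1 / 4)] ([coupling_tail_bound]). *)

(** * Transition semigroups *)

Section Semigroup.
Context {R : realType} {d : measure_display} {S : measurableType d}.
Implicit Types (p : R -> R.-pker S ~> S) (f g : S -> R) (x : S) (s t c : R).

Lemma bounded_fun_of_le f : (exists M, forall x, `|f x| <= M) -> bounded_fun f.
Proof.
by move=> [M fM]; exists M; split=> [|r /ltW Mr x _]; [exact: num_real|
  exact: le_trans Mr].
Qed.

Lemma le_of_bounded_fun f : bounded_fun f -> exists M, forall x, `|f x| <= M.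
Proof. by move=> [M [_ fM]]; exists (M + 1) => x; apply: fM => //; rewrite ltrDl. Qed.

Lemma transition_integrable p t x f : measurable_fun setT f -> bounded_fun f ->
  (p t x).-integrable setT (EFin \o f).
Proof.
move=> mf bf; apply: measurable_bounded_integrable => //.
by rewrite (@prob_kernel _ _ _ _ _ (p t)) ltry.
Qed.

Lemma transition_op_le p t f g x :
  measurable_fun setT f -> bounded_fun f ->
  measurable_fun setT g -> bounded_fun g ->
  (forall y, f y <= g y) -> transition_op p t f x <= transition_op p t g x.
Proof.
by move=> mf bf mg bg fg; apply: le_Rintegral => //; exact: transition_integrable.
Qed.

Lemma transition_op_cst p t c x : transition_op p t (fun=> c) x = c.
Proof.
by rewrite /transition_op Rintegral_cst// (@prob_kernel _ _ _ _ _ (p t)) mulr1.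
Qed.

Lemma transition_opDcst p t f c x : measurable_fun setT f -> bounded_fun f ->
  transition_op p t (fun y => f y + c) x = transition_op p t f x + c.
Proof.
move=> mf bf; rewrite -[in RHS](transition_op_cst p t c x) /transition_op.
rewrite RintegralD//; first exact: transition_integrable.
by apply: transition_integrable => //; apply: bounded_fun_of_le; exists `|c|.
Qed.

Lemma transition_opZ p t f c x : measurable_fun setT f -> bounded_fun f ->
  transition_op p t (fun y => c * f y) x = c * transition_op p t f x.
Proof.
by move=> mf bf; rewrite /transition_op RintegralZl//; exact: transition_integrable.
Qed.

Lemma transition_op_bounded p t f : measurable_fun setT f -> bounded_fun f ->
  bounded_fun (transition_op p t f).
Proof.
move=> mf bf; have [M fM] := le_of_bounded_fun bf; apply: bounded_fun_of_le; exists M => x.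
have bc (k : R) : bounded_fun (fun _ : S => k) by apply: bounded_fun_of_le; exists `|k|.
rewrite ler_norml -[X in X <= _](transition_op_cst p t (- M) x).
rewrite -[X in _ && (_ <= X)](transition_op_cst p t M x).
by apply/andP; split; apply: transition_op_le => // y;
  have := fM y; rewrite ler_norml => /andP[].
Qed.

Lemma EFin_transition_op p t f x : measurable_fun setT f -> bounded_fun f ->
  (transition_op p t f x)%:E = (\int[p t x]_y (f y)%:E)%E.
Proof.
move=> mf bf; rewrite /transition_op /Rintegral fineK//.
by apply: integrable_fin_num => //; exact: transition_integrable.
Qed.

Lemma EFin_transition_op_indic p t (A : set S) x :
  measurable A -> (transition_op p t \1_A x)%:E = p t x A.
Proof.
move=> mA; rewrite EFin_transition_op; first by rewrite integral_indic// setIT.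
  exact: measurable_indic.
apply: bounded_fun_of_le; exists 1 => y; rewrite indicE.
by case: (_ \in _); rewrite ?normr1 ?normr0.
Qed.

Lemma measurable_transition_op p t f :
  measurable_fun setT f -> bounded_fun f ->
  measurable_fun setT (transition_op p t f).
Proof.
move=> mf bf; have [M fM] := le_of_bounded_fun bf.
have mg : measurable_fun setT (fun y => f y + M) by apply: measurable_funD.
have bg : bounded_fun (fun y => f y + M).
  by apply: bounded_fun_of_le; exists (M + `|M|) => x; rewrite (le_trans (ler_normD _ _))// lerD2r.
rewrite (_ : transition_op p t f =
    (fun x => transition_op p t (fun y => f y + M) x - M)); last first.
  by apply/funext => x; rewrite transition_opDcst// addrK.
apply: measurable_funB => //; apply/measurable_EFinP.
rewrite (_ : _ \o _ = fun x => (\int[p t x]_y (f y + M)%:E)%E); last first.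
  by apply/funext => x /=; rewrite EFin_transition_op.
apply: (measurable_fun_integral_kernel (l := p t)) => //.
- by move=> U mU; exact: measurable_kernel.
- by move=> y; rewrite lee_fin -lerBlDr sub0r; have := fM y; rewrite ler_norml => /andP[].
- exact/measurable_EFinP.
Qed.

(** Adding a constant reduces the claim to nonnegative functions, for which it is
Tonelli's theorem for the composition of two kernels. *)
Lemma transition_opD p s t f x : is_transition_semigroup p ->
  0 <= s -> 0 <= t -> measurable_fun setT f -> bounded_fun f ->
  transition_op p (s + t) f x = transition_op p s (transition_op p t f) x.
Proof.
move=> [_ pD] s0 t0 mf bf; have [M fM] := le_of_bounded_fun bf.
have mg : measurable_fun setT (fun y => f y + M) by apply: measurable_funD.
have bg : bounded_fun (fun y => f y + M).
  by apply: bounded_fun_of_le; exists (M + `|M|) => y; rewrite (le_trans (ler_normD _ _))// lerD2r.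
have g0 y : (0 <= (f y + M)%:E)%E.
  by rewrite lee_fin -lerBlDr sub0r; have := fM y; rewrite ler_norml => /andP[].
suff : transition_op p (s + t) (fun y => f y + M) x =
    transition_op p s (transition_op p t (fun y => f y + M)) x.
  rewrite transition_opDcst// => /(canRL (addrK _)) ->.
  rewrite (_ : transition_op p t (fun y => f y + M) =
    fun y => transition_op p t f y + M); last first.
    by apply/funext => y; rewrite transition_opDcst.
  rewrite transition_opDcst ?addrK//; first exact: measurable_transition_op.
  exact: transition_op_bounded.
apply: EFin_inj; rewrite !EFin_transition_op//; last 2 first.
- exact: measurable_transition_op.
- exact: transition_op_bounded.
rewrite (eq_measure_integral (kcomp (p s) (kernel.kernel_snd (T0 := S) (p t)) x)); last first.
  by move=> A mA _; rewrite pD.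
rewrite integral_kcomp//; last exact/measurable_EFinP.
by apply: eq_integral => y _; rewrite EFin_transition_op.
Qed.

(** Only this one-sided consequence of uniform convergence is used; that [h0] does
not depend on [x] is what allows it to be iterated along the semigroup. *)
Lemma generator_uniform p L f e : has_generator p L ->
  measurable_fun setT f -> bounded_fun f -> 0 < e ->
  exists2 h0 : R, 0 < h0 & forall h x, 0 < h < h0 ->
    transition_op p h f x <= f x + h * (L f x + e).
Proof.
move=> gL mf bf e0; have /= gLf := gL f mf bf.
have /gLf : nbhs (L f : {uniform` setT -> R})
    [set g : S -> R | forall x, `|L f x - g x| < e].
  apply/uniform_nbhs; exists [set ab : R * R | `|ab.1 - ab.2| < e]; split.
    exact: (entourage_ball R (PosNum e0)).
  by move=> g /= gE x; exact: gE.
rewrite /= !near_simpl => -[h0 /= h00 gh0]; exists h0 => // h x /andP[h_gt0 hlt].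
have := gh0 h; rewrite /= sub0r normrN gtr0_norm// => /(_ hlt h_gt0 x).
rewrite ltr_distlC => /andP[_ /ltW]; rewrite ler_pdivrMr// lerBlDl.
by rewrite [h * _]mulrC.
Qed.

(** Split [t] into [N] steps so short that one step raises [f] by at most
[t / N * (c + e / t)], uniformly in the starting point.  Positivity of the
semigroup propagates this bound from step to step, and [e] is arbitrary. *)
Lemma transition_op_generator_le p L f c : is_transition_semigroup p ->
  has_generator p L -> measurable_fun setT f -> bounded_fun f ->
  (forall x, L f x <= c) ->
  forall t x, 0 < t -> transition_op p t f x <= f x + t * c.
Proof.
move=> sp gL mf bf Lfc t x t0.
apply/ler_addgt0Pl => e e0.
have et0 : 0 < e / t by rewrite divr_gt0.
have [h0 h00 ph] := generator_uniform gL mf bf et0.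
pose N := (Num.truncn (t / h0)).+1.
pose h := t / N%:R.
have h_gt0 : 0 < h by rewrite divr_gt0// ltr0n.
have hh0 : h < h0.
  rewrite /h ltr_pdivrMr ?ltr0n// mulrC -ltr_pdivrMr//.
  exact: truncnS_gt.
suff it k y : transition_op p (k.+1%:R * h) f y <= f y + (k.+1%:R * h) * (c + e / t).
  have -> : t = N%:R * h by rewrite /h mulrCA divff ?mulr1// pnatr_eq0.
  apply: le_trans (it _ _) _.
  have -> : N%:R * h = t by rewrite /h mulrCA divff ?mulr1// pnatr_eq0.
  by rewrite mulrDr mulrCA divff ?gt_eqF// mulr1 addrA addrC.
elim: k y => [|k IH] y.
  rewrite !mul1r; apply: le_trans (ph _ _ _) _; first by rewrite h_gt0.
  by rewrite lerD2l ler_wpM2l ?(ltW h_gt0)// lerD2r.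
rewrite -[k.+2%:R]natr1 mulrDl mul1r addrC.
rewrite transition_opD ?(ltW h_gt0)//; last by rewrite mulr_ge0 ?(ltW h_gt0).
have mc a : measurable_fun setT (fun y => f y + a) by apply: measurable_funD.
have bc a : bounded_fun (fun y => f y + a).
  have [M fM] := le_of_bounded_fun bf; apply: bounded_fun_of_le; exists (M + `|a|) => z.
  by rewrite (le_trans (ler_normD _ _))// lerD2r.
apply: (le_trans (y := transition_op p h
    (fun z => f z + k.+1%:R * h * (c + e / t)) y)).
  apply: transition_op_le => //.
  - exact: measurable_transition_op.
  - exact: transition_op_bounded.
rewrite transition_opDcst// [in leRHS]mulrDl addrA lerD2r.
apply: le_trans (ph _ _ _) _; first by rewrite h_gt0.
by rewrite lerD2l ler_wpM2l ?(ltW h_gt0)// lerD2r.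
Qed.

Context {d' : measure_display} {T : measurableType d'} (P : probability T R).

(** The Markov property at time [0], with the sure event as conditioning event. *)
Lemma markov_law (X : R -> {RV P >-> S}) p x t (A : set S) :
  markov_property X p -> {ae P, forall w, X 0 w = x} -> 0 <= t ->
  measurable A -> P (X t @^-1` A) = p t x A.
Proof.
move=> mX X0 t0 mA.
have := mX 0 t (lexx 0) t0 setT; rewrite add0r => mX0.
have sT : natural_filtration X 0 setT.
  apply: (@sub_gen_smallest _ (sigma_algebra setT) _ setT); exists 0; rewrite lexx; split=> //.
  by exists setT => //; rewrite preimage_setT.
have := mX0 sT A mA; rewrite setTI => ->.
rewrite (ae_eq_integral (cst (p t x A)))//.
- rewrite integral_cst//.
  by rewrite -[RHS]mule1; congr (_ * _)%E; exact: probability_setT.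
- apply: (measurableT_comp (f := fun y => p t y A)); last exact: measurable_funPT.
  exact: measurable_kernel.
- by case: X0 => N [mN PN sub]; exists N; split => // w /= nw;
    apply: sub => /= Xw; apply: nw; rewrite Xw.
Qed.
End Semigroup.

(** * Generators of the inclusion process and consistency *)

Section Generators.
Context {R : realType}.
Implicit Types (m c : R) (n q : nat).

Definition inclusion_rate n (y : config n) (i : 'I_n) (e : int) : R :=
  \sum_(k < n) (y k == y i + e)%:R.

(** The generator of the first marginal of the coupling; the parts of the jump
rate that come from the random walk and from inclusion are merged. *)
Definition sip_generator n m (f : config n -> R) (y : config n) : R :=
  \sum_(e <- [:: 1; -1] : seq int) \sum_(i < n)
    (m / 2 + inclusion_rate y i e) * (f (jump y i e) - f y).

Definition clustered n (r : int) (y : config n) : bool :=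
  [forall a, forall b, `|y a - y b| <= r].

Lemma inclusion_rate_ge0 n (y : config n) i e : 0 <= inclusion_rate y i e.
Proof. exact: sumr_ge0. Qed.

Lemma inclusion_rate_le n (y : config n) i e : inclusion_rate y i e <= n%:R :> R.
Proof.
rewrite /inclusion_rate -[X in X%:R]card_ord -sumr_const.
by apply: ler_sum => k _; case: eqP => _; rewrite ?ler01.
Qed.

Definition neighbour_pairs n (y : config n) : R :=
  \sum_(e <- [:: 1; -1] : seq int) \sum_(i < n) inclusion_rate y i e.

Lemma neighbour_pairs_ge0 n (y : config n) : 0 <= neighbour_pairs y :> R.
Proof. by apply: sumr_ge0 => e _; apply: sumr_ge0 => i _; exact: inclusion_rate_ge0. Qed.

Lemma neighbour_pairs_le n (y : config n) : neighbour_pairs y <= 2 * n%:R ^+ 2 :> R.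
Proof.
rewrite /neighbour_pairs !big_cons big_nil addr0.
have H e : \sum_(i < n) inclusion_rate y i e <= n%:R ^+ 2 :> R.
  apply: (@le_trans _ _ (\sum_(i < n) n%:R)).
    by apply: ler_sum => i _; exact: inclusion_rate_le.
  by rewrite sumr_const card_ord -[leLHS]mulr_natl expr2.
by have := H 1; have := H (-1); lra.
Qed.

Lemma coupling_generator_fst n m (f : config n -> R) z :
  coupling_generator m (fun z => f z.1) z = sip_generator m f z.1.
Proof.
rewrite /coupling_generator /sip_generator -big_split/=; apply: eq_bigr => e _.
rewrite -big_split/=; apply: eq_bigr => i _.
by rewrite -mulr_suml -mulrDl.
Qed.

Lemma coupling_generatorD n m (f g : coupled_state n -> R) z :
  coupling_generator m (fun z => f z + g z) z =
  coupling_generator m f z + coupling_generator m g z.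
Proof.
rewrite /coupling_generator [RHS]addrACA; congr (_ + _); rewrite -big_split/=;
  apply: eq_bigr => e _; rewrite -big_split/=; apply: eq_bigr => i _.
  by ring.
by rewrite -!big_split/=; apply: eq_bigr => k _; ring.
Qed.

Lemma coupling_generatorZ n m c (f : coupled_state n -> R) z :
  coupling_generator m (fun z => c * f z) z = c * coupling_generator m f z.
Proof.
rewrite /coupling_generator mulrDr !mulr_sumr; congr (_ + _);
  apply: eq_bigr => e _; rewrite !mulr_sumr; apply: eq_bigr => i _.
  by ring.
by rewrite !mulr_sumr; apply: eq_bigr => k _; ring.
Qed.

(** The maximum principle: only increments from [z] enter, each with a
nonnegative rate. *)
Lemma coupling_generator_le n m (f g : coupled_state n -> R) z : 0 <= m ->
  (forall z', f z' - f z <= g z' - g z) ->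
  coupling_generator m f z <= coupling_generator m g z.
Proof.
case: z => y y' m0 fg.
rewrite /coupling_generator lerD//; apply: ler_sum => e _; apply: ler_sum => i _.
  by rewrite ler_wpM2l ?fg// divr_ge0.
by apply: ler_sum => k _; rewrite ler_wpM2l ?fg// ler0n.
Qed.

Lemma sip_generatorZ n m c (f : config n -> R) y :
  sip_generator m (fun y => c * f y) y = c * sip_generator m f y.
Proof.
rewrite /sip_generator mulr_sumr; apply: eq_bigr => e _; rewrite mulr_sumr.
by apply: eq_bigr => i _; ring.
Qed.

Definition subconfig n q (y : config n) (s : {ffun 'I_q -> 'I_n}) : config q :=
  [ffun a => y (s a)].

Definition redirect n q (s : {ffun 'I_q -> 'I_n}) a k : {ffun 'I_q -> 'I_n} :=
  [ffun b => if b == a then k else s b].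

Lemma jump_subconfig n q (y : config n) (s : {ffun 'I_q -> 'I_n}) a k e :
  y k = y (s a) + e -> jump (subconfig y s) a e = subconfig y (redirect s a k).
Proof.
by move=> yk; apply/ffunP => b; rewrite !ffunE; case: eqP => // ->; rewrite yk.
Qed.

(** Injectivity of [s] ensures that at most one particle of the subconfiguration
moves. *)
Lemma subconfig_jump n q (G : config q -> R) (y : config n)
    (s : {ffun 'I_q -> 'I_n}) i e : injective s ->
  G (subconfig (jump y i e) s) - G (subconfig y s) =
  \sum_a (s a == i)%:R * (G (jump (subconfig y s) a e) - G (subconfig y s)).
Proof.
move=> sI; case: (pickP (fun a => s a == i)) => [a /eqP sa|si]; last first.
  have -> : subconfig (jump y i e) s = subconfig y s.
    by apply/ffunP => a; rewrite !ffunE si.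
  by rewrite subrr big1// => a _; rewrite si mul0r.
rewrite (bigD1 a)//= sa eqxx mul1r big1 ?addr0; last first.
  by move=> b ba; rewrite -sa (inj_eq sI) (negbTE ba) mul0r.
have -> // : subconfig (jump y i e) s = jump (subconfig y s) a e.
by apply/ffunP => b; rewrite !ffunE -sa (inj_eq sI).
Qed.

Lemma inclusion_rate_subconfig n q (y : config n) (s : {ffun 'I_q -> 'I_n}) a e :
  injective s ->
  inclusion_rate y (s a) e = inclusion_rate (subconfig y s) a e +
    \sum_(k | k \notin codom s) (y k == y (s a) + e)%:R.
Proof.
move=> sI; rewrite /inclusion_rate (bigID (mem (codom s)))/=; congr (_ + _).
rewrite -big_uniq/=; last by rewrite map_inj_uniq ?enum_uniq.
by rewrite big_image/=; apply: eq_bigr => b _; rewrite !ffunE.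
Qed.

Lemma redirect_injective n q (s : {ffun 'I_q -> 'I_n}) a k :
  injective s -> k \notin codom s ->
  injective (redirect s a k) /\ s a \notin codom (redirect s a k).
Proof.
move=> sI ks; split=> [b c|].
  rewrite !ffunE; case: eqP => [->|ba]; case: eqP => [->|ca] // E.
  - by rewrite E codom_f in ks.
  - by rewrite -E codom_f in ks.
  - exact: sI.
apply/negP => /codomP[b]; rewrite ffunE; case: (b =P a) => [_|ba] E.
  by rewrite -E codom_f in ks.
by apply: ba; apply: sI.
Qed.

Lemma redirectK n q (s : {ffun 'I_q -> 'I_n}) a k :
  redirect (redirect s a k) a (s a) = s.
Proof. by apply/ffunP => b; rewrite !ffunE; case: eqP => [->|]. Qed.

(** Particle [s a] jumping onto particle [k] in direction [e] and particle [k]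
jumping onto particle [s a] in direction [- e] have the same
inclusion rate.  Exchanging
the roles of the two particles in the labelling turns the increment of one
jump into minus the increment of the other, so the sum is antisymmetric under
the involution [(s, k) -> (redirect s a k, s a)]. *)
Lemma outer_inclusion_cancel n q (G : config q -> R) (y : config n) a :
  \sum_(e <- [:: 1; -1] : seq int)
    \sum_(sk : {ffun 'I_q -> 'I_n} * 'I_n |
        injectiveb sk.1 && (sk.2 \notin codom sk.1))
      (y sk.2 == y (sk.1 a) + e)%:R *
        (G (jump (subconfig y sk.1) a e) - G (subconfig y sk.1)) = 0.
Proof.
rewrite !big_cons big_nil addr0 [X in _ + X](reindex_onto
  (fun sk : {ffun 'I_q -> 'I_n} * 'I_n => (redirect sk.1 a sk.2, sk.1 a))
  (fun sk : {ffun 'I_q -> 'I_n} * 'I_n => (redirect sk.1 a sk.2, sk.1 a)))/=; last first.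
  by move=> [s k] _ /=; rewrite redirectK ffunE eqxx.
rewrite [X in _ + X](eq_bigl (fun sk : {ffun 'I_q -> 'I_n} * 'I_n =>
   injectiveb sk.1 && (sk.2 \notin codom sk.1))); last first.
  move=> [s k] /=; rewrite redirectK ffunE eqxx eqxx andbT.
  apply/andP/andP => -[/injectiveP sI ks].
    have [] := redirect_injective a sI ks.
    by rewrite redirectK ffunE eqxx => /injectiveP ? ?.
  by have [/injectiveP] := redirect_injective a sI ks.
rewrite -big_split/= big1// => -[s k] /=.
move=> /andP[/injectiveP sI ks]; rewrite !ffunE eqxx.
rewrite (_ : (y (s a) == y k + -1) = (y k == y (s a) + 1)); last first.
  by rewrite eq_sym subr_eq.
have [yk|_] := eqVneq (y k) (y (s a) + 1); last by rewrite !mul0r addr0.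
rewrite (jump_subconfig yk) (@jump_subconfig _ _ _ _ _ (s a)) ?redirectK.
  by rewrite !mul1r -opprB addNr.
by rewrite ffunE eqxx yk addrK.
Qed.

(** The error term collects the inclusion jumps towards particles outside of the
subconfiguration; it vanishes only after summation over all labellings. *)
Lemma sip_generator_subconfig n q m (G : config q -> R) (y : config n)
    (s : {ffun 'I_q -> 'I_n}) : injective s ->
  sip_generator m (fun y => G (subconfig y s)) y =
  sip_generator m G (subconfig y s) +
  \sum_(e <- [:: 1; -1] : seq int) \sum_a
    (\sum_(k | k \notin codom s) (y k == y (s a) + e)%:R) *
    (G (jump (subconfig y s) a e) - G (subconfig y s)).
Proof.
move=> sI; rewrite -big_split/=; apply: eq_bigr => e _; rewrite -big_split/=.
transitivity (\sum_a \sum_i (s a == i)%:R * ((m / 2 + inclusion_rate y (s a) e) *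
    (G (jump (subconfig y s) a e) - G (subconfig y s)))).
  rewrite exchange_big/=; apply: eq_bigr => i _.
  rewrite subconfig_jump// mulr_sumr; apply: eq_bigr => a _.
  by rewrite mulrCA; case: eqP => [->|_]; rewrite ?mul0r.
apply: eq_bigr => a _; rewrite (bigD1 (s a))//= eqxx mul1r big1 ?addr0; last first.
  by move=> i; rewrite eq_sym => /negbTE ->; rewrite mul0r.
by rewrite inclusion_rate_subconfig// addrA mulrDl.
Qed.

Lemma sip_generator_sum n m (I : finType) (P : pred I) (f : I -> config n -> R) y :
  sip_generator m (fun y => \sum_(x | P x) f x y) y =
  \sum_(x | P x) sip_generator m (f x) y.
Proof.
rewrite /sip_generator [RHS]exchange_big/=; apply: eq_bigr => e _.
rewrite [RHS]exchange_big/=; apply: eq_bigr => i _.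
by rewrite -sumrB mulr_sumr.
Qed.

(** Consistency of the inclusion process: on sums over all labellings, the
[n]-particle generator acts through the [q]-particle one. *)
Lemma sip_generator_consistent n q m (G : config q -> R) (y : config n) :
  sip_generator m (fun y => \sum_(s : {ffun 'I_q -> 'I_n} | injectiveb s)
    G (subconfig y s)) y =
  \sum_(s : {ffun 'I_q -> 'I_n} | injectiveb s)
    sip_generator m G (subconfig y s).
Proof.
rewrite sip_generator_sum.
under eq_bigr => s sI do rewrite (sip_generator_subconfig _ _ _ (injectiveP _ sI)).
rewrite big_split/= [X in _ + X](_ : _ = 0) ?addr0//.
rewrite exchange_big/=; under eq_bigr do rewrite exchange_big/=.
rewrite exchange_big/= big1// => a _.
rewrite -[RHS](outer_inclusion_cancel G y a); apply: eq_bigr => e _.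
under eq_bigr do rewrite mulr_suml.
by rewrite pair_big_dep/=.
Qed.
End Generators.

(** * Fourth roots and saturation *)

Section FourthRoot.
Context {R : realType}.
Implicit Types (s r t x : R).

Definition fourth_root (q : R) := Num.sqrt (Num.sqrt q).

Lemma fourth_rootK q : 0 <= q -> fourth_root q ^+ 4 = q.
Proof. by move=> q0; rewrite (exprM _ 2 2) !sqr_sqrtr ?sqrtr_ge0. Qed.

Lemma fourth_root_gt0 q : 0 < q -> 0 < fourth_root q.
Proof. by move=> q0; rewrite !sqrtr_gt0. Qed.

Lemma fourth_power_near1 t : 0 < t -> 9 / 10 <= t ^+ 4 -> 97 / 100 <= t.
Proof.
move=> t0 t4; rewrite leNgt; apply/negP => tl.
have t2 : t ^+ 2 < 941 / 1000 by nra.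
have t20 : 0 < t ^+ 2 by rewrite exprn_gt0.
have : t ^+ 4 < 9 / 10 by rewrite (exprM _ 2 2) expr2; nra.
by lra.
Qed.

(** With [t ^ 4 = 1 + x] this is a lower bound for the fourth root of [1 + x].
The exact second-order coefficient at [x = 0] is [12 / 128]; what matters later
is that [13 / 128] leaves room below [16 / 128], the value at which the fourth
root would stop being subharmonic in the plane. *)
Lemma fourth_root_taylor t : 0 < t -> 9 / 10 <= t ^+ 4 ->
  (t ^+ 4 - 1) / 4 - 13 / 128 * (t ^+ 4 - 1) ^+ 2 <= t - 1.
Proof.
move=> t0 /(fourth_power_near1 t0) tl.
pose p := t ^+ 3 + t ^+ 2 + t + 1.
have pl : 382 / 100 + 57 / 10 * (t - 97 / 100) <= p.
  have v0 : 0 <= t - 97 / 100 by lra.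
  have := exprn_ge0 2 v0; have := exprn_ge0 3 v0; rewrite /p; lra.
have p2 : (382 / 100 + 57 / 10 * (t - 97 / 100)) ^+ 2 <= p ^+ 2.
  by rewrite lerXn2r// ?nnegrE; nra.
(* [p] is bounded below by a line that almost touches it at [97 / 100], where
   the inequality [key] is tightest. *)
have key : 32 * (t ^+ 2 + 2 * t + 3) <= 13 * p ^+ 2 by nra.
rewrite -subr_ge0.
have -> : t - 1 - ((t ^+ 4 - 1) / 4 - 13 / 128 * (t ^+ 4 - 1) ^+ 2) =
  (t - 1) ^+ 2 * ((13 * p ^+ 2 - 32 * (t ^+ 2 + 2 * t + 3)) / 128).
  by rewrite /p; field.
by rewrite mulr_ge0 ?sqr_ge0// divr_ge0 ?subr_ge0.
Qed.

Lemma fourth_root_lipschitz t : 0 < t -> 9 / 10 <= t ^+ 4 ->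
  (t - 1) ^+ 2 <= (t ^+ 4 - 1) ^+ 2 / 9.
Proof.
move=> t0 /(fourth_power_near1 t0) tl.
have -> : t ^+ 4 - 1 = (t - 1) * (t ^+ 3 + t ^+ 2 + t + 1) by ring.
rewrite exprMn -mulrA -[leLHS]mulr1 ler_wpM2l ?sqr_ge0//.
have t2 : 94 / 100 <= t ^+ 2 by nra.
have t3 : 91 / 100 <= t ^+ 3 by rewrite exprS; nra.
set p := (X in X ^+ 2 / 9).
have pl : 3 <= p by rewrite /p; lra.
nra.
Qed.

(** A smooth substitute for the minimum of [s] and [r]: slope almost [1] for [r]
much smaller than [s], bounded by [s], concave. *)
Definition saturate s r := s * r / (s + r).

Lemma saturate_ge0 s r : 0 < s -> 0 <= r -> 0 <= saturate s r.
Proof. by move=> s0 r0; rewrite /saturate divr_ge0 ?mulr_ge0 ?addr_ge0 ?(ltW s0). Qed.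

Lemma saturate_le s r : 0 < s -> 0 <= r -> saturate s r <= s.
Proof.
move=> s0 r0; rewrite /saturate ler_pdivrMr ?ltr_pwDl//.
by rewrite ler_wpM2l ?(ltW s0)// lerDr ltW.
Qed.

Lemma saturate_sub s (u v : R) : 0 < s -> 0 <= u -> 0 <= v ->
  saturate s v - saturate s u = s ^+ 2 * (v - u) / ((s + u) * (s + v)).
Proof.
move=> s0 u0 v0; rewrite /saturate.
have su : 0 < s + u by lra.
have sv : 0 < s + v by lra.
by field; rewrite !gt_eqF.
Qed.

(** The second-order Taylor bound for the saturated fourth root, with [r ^ 4] as
the variable and [x] its relative increment.  Saturation multiplies the bound by
the slope [s ^ 2 / (s + r) ^ 2] and worsens the second-order coefficient by the
term with [r / (9 * (s + r'))], negligible as long as [r] is small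
compared to [s]. *)
Lemma saturate_fourth_root s r r' x : 0 < s -> 0 < r -> 0 < r' ->
  r' ^+ 4 = r ^+ 4 * (1 + x) -> - (1 / 10) <= x ->
  s ^+ 2 * r / (s + r) ^+ 2 *
    (x / 4 - (13 / 128 + r / (9 * (s + r'))) * x ^+ 2) <=
  saturate s r' - saturate s r.
Proof.
move=> s0 r0 r'0 rx xl.
pose t := r' / r.
have t0 : 0 < t by rewrite divr_gt0.
have r'E : r' = r * t by rewrite /t mulrC divfK ?gt_eqF.
have t4 : t ^+ 4 = 1 + x.
  by rewrite /t expr_div_n rx mulrC mulKf// expf_neq0// gt_eqF.
have t4l : 9 / 10 <= t ^+ 4 by rewrite t4; lra.
have := fourth_root_taylor t0 t4l; have := fourth_root_lipschitz t0 t4l.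
have -> : t ^+ 4 - 1 = x by rewrite t4 addrC addKr.
move=> L1 L2.
have sr : 0 < s + r by rewrite addr_gt0.
have sr' : 0 < s + r' by rewrite addr_gt0.
have -> : saturate s r' - saturate s r =
    s ^+ 2 * r / (s + r) ^+ 2 * ((t - 1) - r / (s + r') * (t - 1) ^+ 2).
  rewrite /saturate; move: sr sr'; rewrite r'E => sr sr'.
  by field; rewrite !gt_eqF.
rewrite ler_wpM2l//.
  by rewrite divr_ge0 ?mulr_ge0 ?sqr_ge0// ltW.
have q0 : 0 <= r / (s + r') by rewrite divr_ge0 ?ltW.
have -> : r / (9 * (s + r')) = r / (s + r') / 9 by rewrite invfM mulrA mulrAC.
nra.
Qed.
End FourthRoot.

(** * Two particles *)

Section TwoParticles.
Context {R : realType}.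
Implicit Types (m s : R) (g : int -> R) (z : int).

Definition pair_function g (y : config 2) : R := g (y ord0 - y ord_max).

Lemma sip_generator_pair m g (y : config 2) (z := y ord0 - y ord_max) :
  sip_generator m (pair_function g) y =
  m * (g (z + 1) + g (z - 1) - 2 * g z) +
  2 * ((z == 1)%:R * (g 0 - g 1) + (z == -1)%:R * (g 0 - g (-1))).
Proof.
rewrite /sip_generator /inclusion_rate /pair_function !big_cons big_nil addr0.
rewrite !big_ord_recl !big_ord0 !addr0 !ffunE /=.
have -> : lift ord0 ord0 = ord_max :> 'I_2 by exact/val_inj.
rewrite -/z; set a := y ord0; set b := y ord_max.
have za : a = z + b by rewrite /z subrK.
have -> : (a == a + 1) = false by lia.
have -> : (a == a + -1) = false by lia.
have -> : (b == b + 1) = false by lia.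
have -> : (b == b + -1) = false by lia.
have -> : (b == a + 1) = (z == -1) by lia.
have -> : (a == b + 1) = (z == 1) by lia.
have -> : (b == a + -1) = (z == 1) by lia.
have -> : (a == b + -1) = (z == -1) by lia.
have -> : a + 1 - b = z + 1 by rewrite za; ring.
have -> : a + -1 - b = z - 1 by rewrite za; ring.
have -> : a - (b + 1) = z - 1 by rewrite za; ring.
have -> : a - (b + -1) = z + 1 by rewrite za; ring.
have [->|_] := eqVneq z 1.
  by rewrite (_ : (1 == -1 :> int) = false)// subrr /=; field.
by have [->|_] := eqVneq z (-1); [rewrite addNr /=; field|rewrite /=; field].
Qed.

(** The midpoint of [2 / (m + 2)] and [1].  Below [1] the potential increases when
two particles leave a common site; above [2 / (m + 2)] the outward random-walk
jumps from separation one outweigh the attraction by inclusion. *)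
Definition contact_value m : R := (m + 4) / (2 * (m + 2)).

Definition pair_potential m s z : R :=
  saturate s (if z == 0 then contact_value m else `|z|%:~R).

Lemma int_small z : `|z| <= 1 -> [\/ z = 0, z = 1 | z = -1].
Proof.
move=> z1; have : z = 0 \/ z = 1 \/ z = -1 by lia.
by move=> [|[|]] ->; [exact: Or31|exact: Or32|exact: Or33].
Qed.

Lemma int_large z : 1 < `|z| -> [/\ z != 0, z != 1, z != -1, z + 1 != 0 & z - 1 != 0] /\
  ((`|z + 1| = `|z| + 1 /\ `|z - 1| = `|z| - 1) \/
   (`|z + 1| = `|z| - 1 /\ `|z - 1| = `|z| + 1)).
Proof. by move=> z1; split; [split; lia|lia]. Qed.

Lemma contact_valueE m : 0 < m -> 1 - contact_value m = m / (2 * (m + 2)).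
Proof. by move=> m0; rewrite /contact_value; field; rewrite gt_eqF//; lra. Qed.

Lemma contact_value_itv m : 0 < m -> 0 < contact_value m < 1.
Proof.
move=> m0; have := contact_valueE m0; set q := m / _ => qE.
have q0 : 0 < q by rewrite divr_gt0//; lra.
by rewrite /contact_value divr_gt0/= ?ltr_pdivrMr; lra.
Qed.

(** Away from the origin only the concavity of the truncation is felt. *)
Lemma saturate_far m s (u : R) : 0 < m -> 0 < s -> 2 <= u ->
  - (2 * m / s) <=
    m * (saturate s (u + 1) + saturate s (u - 1) - 2 * saturate s u).
Proof.
move=> m0 s0 u2.
have -> : saturate s (u + 1) + saturate s (u - 1) - 2 * saturate s u =
    - (2 * s ^+ 2 / ((s + u) * (s + u + 1) * (s + u - 1))).
  by rewrite /saturate; field; rewrite !gt_eqF; lra.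
set D := (s + u) * (s + u + 1) * (s + u - 1).
have sD : s ^+ 3 <= D.
  have -> : D = (s + u) * ((s + u) ^+ 2 - 1) by rewrite /D; ring.
  by rewrite exprS ler_pM ?sqr_ge0; nra.
have s30 : 0 < s ^+ 3 by rewrite exprn_gt0.
rewrite mulrN lerN2.
have -> : 2 * m / s = m * (2 * s ^+ 2 / s ^+ 3) by field; rewrite gt_eqF.
rewrite ler_wpM2l ?(ltW m0)//; apply: ler_wpM2l; first by nra.
by rewrite lef_pV2 ?posrE//; lra.
Qed.

Lemma saturate_contact0 m s : 0 < m -> 4 <= s ->
  m ^+ 2 / (2 * (m + 2)) <=
  m * (saturate s 1 + saturate s 1 - 2 * saturate s (contact_value m)).
Proof.
move=> m0 s4; have /andP[b0 b1] := contact_value_itv m0.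
have -> : saturate s 1 + saturate s 1 - 2 * saturate s (contact_value m) =
  2 * (saturate s 1 - saturate s (contact_value m)) by ring.
rewrite saturate_sub ?(ltW b0)//; last lra.
rewrite contact_valueE//; set D := (s + contact_value m) * (s + 1).
have D0 : 0 < D by rewrite mulr_gt0; lra.
have -> : m * (2 * (s ^+ 2 * (m / (2 * (m + 2))) / D)) =
  m ^+ 2 / (2 * (m + 2)) * (2 * s ^+ 2 / D).
  by field; rewrite !gt_eqF//; lra.
rewrite ler_peMr//; first by rewrite divr_ge0 ?sqr_ge0//; lra.
rewrite ler_pdivlMr// mul1r /D; nra.
Qed.

Lemma saturate_contact1 m s : 0 < m -> 4 <= s ->
  m / 8 <=
  m * (saturate s 2 + saturate s (contact_value m) - 2 * saturate s 1)
  + 2 * (saturate s (contact_value m) - saturate s 1).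
Proof.
move=> m0 s4; have /andP[b0 b1] := contact_value_itv m0.
have -> : m * (saturate s 2 + saturate s (contact_value m) - 2 * saturate s 1)
  + 2 * (saturate s (contact_value m) - saturate s 1) =
  m * (saturate s 2 - saturate s 1)
  - (m + 2) * (saturate s 1 - saturate s (contact_value m)) by ring.
have s0 : 0 < s by lra.
rewrite !saturate_sub ?(ltW b0)// contact_valueE//.
have -> : (m + 2) * (s ^+ 2 * (m / (2 * (m + 2))) / ((s + contact_value m) * (s + 1))) =
  m * (s ^+ 2 / (2 * (s + contact_value m) * (s + 1))).
  by field; rewrite !gt_eqF//; lra.
have -> : m * (s ^+ 2 * (2 - 1) / ((s + 1) * (s + 2))) =
  m * (s ^+ 2 / ((s + 1) * (s + 2))) by congr (_ * (_ / _)); ring.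
rewrite -mulrBr ler_wpM2l ?(ltW m0)//.
apply: (@le_trans _ _ (s ^+ 2 / ((s + 1) * (s + 2)) - s ^+ 2 / (2 * s * (s + 1)))).
  have -> : s ^+ 2 / ((s + 1) * (s + 2)) - s ^+ 2 / (2 * s * (s + 1)) =
    s * (s - 2) / (2 * (s + 1) * (s + 2)) by field; rewrite !gt_eqF//; lra.
  rewrite ler_pdivlMr ?mulr_gt0//; nra.
rewrite lerD2l lerN2 ler_wpM2l ?sqr_ge0// lef_pV2 ?posrE ?mulr_gt0//; nra.
Qed.

(** The three regimes are separation zero, one, and at least two; inclusion acts
only in the second one. *)
Lemma pair_potential_lower m s (y : config 2) : 0 < m -> 4 <= s ->
  Num.min (m / 8) (m ^+ 2 / (2 * (m + 2))) * (clustered 1 y)%:R - 2 * m / s <=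
  sip_generator m (pair_function (pair_potential m s)) y.
Proof.
move=> m0 s4; rewrite sip_generator_pair; set z := y ord0 - y ord_max.
have cl : clustered 1 y -> (`|z| <= 1)%R by move=> /forallP/(_ ord0)/forallP/(_ ord_max).
have s0 : 0 < s by lra.
set c := Num.min _ _.
have c0 : 0 < c by rewrite lt_min !divr_gt0 ?exprn_gt0 ?mulr_gt0//; lra.
have c1 : c <= m / 8 by rewrite ge_min lexx.
have c2 : c <= m ^+ 2 / (2 * (m + 2)) by rewrite ge_min lexx orbT.
have ms0 : 0 <= 2 * m / s by rewrite divr_ge0// ?mulr_ge0// ltW.
have near_le : c * (clustered 1 y)%:R - 2 * m / s <= c.
  by case: clustered; rewrite ?mulr1 ?mulr0; lra.
have ppE (x : int) (k : R) : x != 0 -> `|x|%:~R = k ->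
    pair_potential m s x = saturate s k.
  by move=> x0 <-; rewrite /pair_potential (negbTE x0).
have pp0 : pair_potential m s 0 = saturate s (contact_value m).
  by rewrite /pair_potential eqxx.
have [z1|z1] := leP `|z| 1.
  apply: le_trans near_le _.
  have p1 : pair_potential m s 1 = saturate s 1 by exact: ppE.
  have pN1 : pair_potential m s (-1) = saturate s 1 by exact: ppE.
  have p2 : pair_potential m s 2 = saturate s 2 by exact: ppE.
  have pN2 : pair_potential m s (-2) = saturate s 2 by exact: ppE.
  case: (int_small z1) => ->.
  - rewrite add0r sub0r p1 pN1 pp0 (_ : (0 == -1 :> int) = false)//.
    rewrite (_ : (0 == 1 :> int) = false)// !mul0r addr0 mulr0 addr0.
    exact: le_trans c2 (saturate_contact0 m0 s4).
  - rewrite (_ : (1 == -1 :> int) = false)// eqxx mul0r addr0 mul1r subrr.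
    rewrite (_ : 1 + 1 = 2 :> int)// p2 pp0 p1.
    exact: le_trans c1 (saturate_contact1 m0 s4).
  - rewrite (_ : (-1 == 1 :> int) = false)// eqxx mul0r add0r mul1r addNr.
    rewrite (_ : -1 - 1 = -2 :> int)// pN2 pp0 pN1 [saturate s _ + saturate s 2]addrC.
    exact: le_trans c1 (saturate_contact1 m0 s4).
have -> : clustered 1 y = false.
  by apply/negP => /cl; rewrite leNgt z1.
rewrite mulr0 sub0r.
have [[z_0 z_1 zN1 zp zm] zpm] := int_large z1.
rewrite (negbTE z_1) (negbTE zN1) !mul0r addr0 mulr0 addr0.
pose u : R := `|z|%:~R.
have u2 : 2 <= u by rewrite /u (ler_int _ 2).
apply: le_trans (saturate_far m0 s0 u2) _; rewrite ler_wpM2l ?(ltW m0)//.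
rewrite (ppE z u)//; move: zpm => [|] [Ep Em].
  rewrite (ppE (z + 1) (u + 1)) ?(ppE (z - 1) (u - 1)) ?Ep ?Em//.
  - by rewrite rmorphB.
  - by rewrite rmorphD.
rewrite (ppE (z + 1) (u - 1)) ?(ppE (z - 1) (u + 1)) ?Ep ?Em//.
- by rewrite [saturate s (u + 1) + _]addrC.
- by rewrite rmorphD.
- by rewrite rmorphB.
Qed.

(** The scale [s] is free: a larger [s] makes the error smaller and the function
larger.  Summed over a time [T], this bounds the time during which two particles
are close by a constant times [s + T / s]. *)
Lemma pair_lyapunov m : 0 < m -> exists2 C : R, 0 < C & forall s, 4 <= s ->
  exists G : config 2 -> R, forall y, 0 <= G y <= C * s /\
    (clustered 1 y)%:R - C / s <= sip_generator m G y.
Proof.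
move=> m0; set c := Num.min (m / 8) (m ^+ 2 / (2 * (m + 2))).
have c0 : 0 < c by rewrite lt_min !divr_gt0 ?exprn_gt0 ?mulr_gt0//; lra.
exists ((1 + 2 * m) / c); first by rewrite divr_gt0//; lra.
move=> s s4; exists (fun y => c^-1 * pair_function (pair_potential m s) y) => y.
have s0 : 0 < s by lra.
have /andP[b0 _] := contact_value_itv m0.
split.
  set v := pair_function _ _.
  have : 0 <= v <= s.
    rewrite /v /pair_function /pair_potential.
    set u := (X in saturate s X).
    have u0 : 0 <= u by rewrite /u; case: ifP => _; rewrite ?(ltW b0)// ler0z.
    by rewrite saturate_ge0// saturate_le.
  move=> /andP[v0 vs]; rewrite mulr_ge0 ?invr_ge0 ?(ltW c0)//=.
  rewrite [leLHS]mulrC ler_pdivrMr// mulrAC divfK ?gt_eqF//.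
  nra.
have := pair_potential_lower y m0 s4; rewrite -/c => H.
rewrite sip_generatorZ.
rewrite [leRHS]mulrC ler_pdivlMr//; apply: le_trans H.
have -> : ((clustered 1 y)%:R - (1 + 2 * m) / c / s) * c =
    c * (clustered 1 y)%:R - (1 + 2 * m) / s by field; rewrite !gt_eqF.
by rewrite lerD2l lerN2 ler_wpM2r ?invr_ge0//; lra.
Qed.
End TwoParticles.

(** * Three particles: the quadratic potential *)

Section ThreeParticles.
Context {R : realType}.
Implicit Types (m s B : R) (z : int).

Lemma sum_injective_pairs n (H : 'I_n -> 'I_n -> R) :
  \sum_(s : {ffun 'I_2 -> 'I_n} | injectiveb s) H (s ord0) (s ord_max) =
  \sum_i \sum_(j | j != i) H i j.
Proof.
rewrite pair_big_dep/=.
rewrite (reindex_onto (fun s : {ffun 'I_2 -> 'I_n} => (s ord0, s ord_max))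
  (fun ij : 'I_n * 'I_n => [ffun a : 'I_2 => if a == ord0 then ij.1 else ij.2]))/=; last first.
  by move=> [i j] _; rewrite !ffunE.
apply: eq_bigl => s; rewrite (_ : [ffun a => _] == s); last first.
  apply/eqP/ffunP => a; rewrite ffunE; case: eqP => [->//|/eqP a0].
  by congr (s _); apply/val_inj; case: a a0 => -[|[|]].
rewrite andbT; apply/injectiveP/idP => [sI|s01 a b].
  by rewrite (inj_eq sI).
have E (c : 'I_2) : c = ord0 \/ c = ord_max.
  by case: c => -[|[|//]] c2; [left|right]; exact/val_inj.
by case: (E a) (E b) => -> [] -> // /eqP; rewrite ?(negbTE s01)// eq_sym (negbTE s01).
Qed.

(** The second term equals [B * maxr 1 |z|].  Its generator image is [B * m] on
neighbouring pairs and zero elsewhere; this compensates for the attraction,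
which lowers the image of [z ^ 2] on neighbouring pairs, with room to spare when
[B] is large. *)
Definition quadratic_potential B z : R :=
  z%:~R ^+ 2 + B * (if z == 0 then 1 else `|z|%:~R).

Lemma quadratic_potentialN B z :
  quadratic_potential B (- z) = quadratic_potential B z.
Proof. by rewrite /quadratic_potential rmorphN sqrrN oppr_eq0 normrN. Qed.

Lemma quadratic_potential_step B z e : 0 <= B -> e = 1 \/ e = -1 ->
  `|quadratic_potential B (z + e) - quadratic_potential B z
    - 2 * e%:~R * z%:~R| <= 1 + B.
Proof.
move=> B0 e1; rewrite /quadratic_potential.
set u' : R := if z + e == 0 then _ else _; set u : R := if z == 0 then _ else _.
have uu' : `|u' - u| <= 1.
  have maxE (x : int) : (if x == 0 then 1 else `|x|%:~R) = (Num.max `|x| 1)%:~R :> R.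
    by have [->|x0] := eqVneq x 0; [rewrite normr0|congr _%:~R; lia].
  rewrite /u /u' !maxE -rmorphB/= -intr_norm -[1]/(1%:~R) ler_int; clear -e1; lia.
have e2 : e%:~R ^+ 2 = 1 :> R by case: e1 => ->; rewrite ?rmorphN ?sqrrN expr1n.
have -> : (z + e)%:~R ^+ 2 + B * u' - (z%:~R ^+ 2 + B * u) - 2 * e%:~R * z%:~R =
   e%:~R ^+ 2 + B * (u' - u) by rewrite rmorphD/=; ring.
rewrite e2 (le_trans (ler_normD _ _))// normr1 lerD2l normrM ger0_norm//.
by rewrite ler_piMr.
Qed.

Lemma sip_generator_quadratic m B (y : config 2) (z := y ord0 - y ord_max) :
  sip_generator m (pair_function (quadratic_potential B)) y =
  2 * m + (B * m - 2) * ((z == 1)%:R + (z == -1)%:R).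
Proof.
rewrite sip_generator_pair -/z; clearbody z.
have [z1|z1] := leP `|z| 1.
  have q0 : quadratic_potential B 0 = B.
    by rewrite /quadratic_potential eqxx expr0n mulr1 add0r.
  have q1 : quadratic_potential B 1 = 1 + B.
    by rewrite /quadratic_potential/= normr1 expr1n mulr1.
  have q2 : quadratic_potential B 2 = 4 + 2 * B.
    by rewrite /quadratic_potential/= (_ : `|2| = 2 :> int)//; ring.
  have qN1 : quadratic_potential B (-1) = 1 + B by rewrite quadratic_potentialN.
  have qN2 : quadratic_potential B (-2) = 4 + 2 * B by rewrite quadratic_potentialN.
  case: (int_small z1) => ->.
  - rewrite add0r sub0r q0 q1 qN1 (_ : (0 == 1 :> int) = false)//.
    by rewrite (_ : (0 == -1 :> int) = false)//=; ring.
  - rewrite (_ : 1 + 1 = 2 :> int)// subrr q0 q1 q2 (_ : (1 == -1 :> int) = false)//.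
    by rewrite eqxx /=; ring.
  - rewrite (_ : -1 - 1 = -2 :> int)// addNr q0 qN1 qN2.
    by rewrite (_ : (-1 == 1 :> int) = false)// eqxx /=; ring.
have [[z_0 z_1 zN1 zp zm] zpm] := int_large z1.
rewrite (negbTE z_1) (negbTE zN1) /quadratic_potential.
rewrite (negbTE z_0) (negbTE zp) (negbTE zm).
by move: zpm => [|] [-> ->]; rewrite !rmorphD !rmorphN/=; ring.
Qed.

Definition triple_potential a B (y : config 3) : R :=
  a + \sum_(s : {ffun 'I_2 -> 'I_3} | injectiveb s)
        pair_function (quadratic_potential B) (subconfig y s).

(** Consistency reduces the three-particle computation to pairs; the twelve is
twice the number of ordered pairs. *)
Lemma sip_generator_triple_potential m a B (y : config 3) :
  sip_generator m (triple_potential a B) y =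
  12 * m + (B * m - 2) * neighbour_pairs y.
Proof.
have -> : sip_generator m (triple_potential a B) y =
    sip_generator m (fun y => \sum_(s : {ffun 'I_2 -> 'I_3} | injectiveb s)
        pair_function (quadratic_potential B) (subconfig y s)) y.
  apply: eq_bigr => e _; apply: eq_bigr => i _.
  by rewrite /triple_potential opprD addrACA subrr add0r.
rewrite sip_generator_consistent.
under eq_bigr do rewrite sip_generator_quadratic !ffunE.
rewrite big_split/=; congr (_ + _); last rewrite -mulr_sumr; last congr (_ * _).
  rewrite (sum_injective_pairs (fun _ _ => 2 * m)).
  under eq_bigr do rewrite sumr_const cardC1 card_ord.
  by rewrite sumr_const card_ord -mulrnA -[LHS]mulr_natr/=; ring.
rewrite (sum_injective_pairs
  (fun i j => (y i - y j == 1)%:R + (y i - y j == -1)%:R)).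
rewrite /neighbour_pairs !big_cons big_nil addr0 -big_split/=.
apply: eq_bigr => i _; rewrite /inclusion_rate -big_split/= [RHS](bigD1 i)//=.
have -> : (y i == y i + 1) = false by lia.
have -> : (y i == y i + -1) = false by lia.
rewrite !add0r; apply: eq_bigr => j _; rewrite addrC.
by congr (_%:R + _%:R); apply/eqP/eqP; lia.
Qed.

Definition spread (y : config 3) (j : 'I_3) : R := \sum_k (y j - y k)%:~R.

Lemma sum_three (F : 'I_3 -> R) (j k l : 'I_3) :
  j != k -> j != l -> k != l -> \sum_i F i = F j + F k + F l.
Proof.
move=> jk jl kl; rewrite (bigD1 j)//= (bigD1 k) 1?eq_sym//=.
rewrite (bigD1 l) ?[l == _]eq_sym ?jl//= big1 ?addr0 ?addrA// => i.
move: jk jl kl; rewrite -!val_eqE/=.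
by case: i j k l => [i ?] [j ?] [k ?] [l ?] /=; lia.
Qed.

Lemma triple_potentialE a B (y : config 3) (j k l : 'I_3) :
  j != k -> j != l -> k != l ->
  triple_potential a B y = a +
  2 * (quadratic_potential B (y j - y k) + quadratic_potential B (y j - y l) +
       quadratic_potential B (y k - y l)).
Proof.
move=> jk jl kl; rewrite /triple_potential /pair_function.
under eq_bigr do rewrite !ffunE.
rewrite (sum_injective_pairs (fun i j => quadratic_potential B (y i - y j))).
under eq_bigr do rewrite big_mkcond/= (sum_three _ jk jl kl).
rewrite (sum_three _ jk jl kl) !eqxx/= ![_ == j]eq_sym [l == k]eq_sym jk jl kl/=.
rewrite -[y k - y j]opprB -[y l - y j]opprB -[y l - y k]opprB.
by rewrite !quadratic_potentialN; ring.
Qed.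

Lemma other_two (j : 'I_3) : exists k l, [/\ j != k, j != l & k != l].
Proof.
case: j => -[|[|[|//]]] j3.
- by exists (inord 1), (inord 2); rewrite -!val_eqE/= !inordK.
- by exists (inord 0), (inord 2); rewrite -!val_eqE/= !inordK.
- by exists (inord 0), (inord 1); rewrite -!val_eqE/= !inordK.
Qed.

Lemma triple_potential_step a B (y : config 3) j e : 0 <= B -> e = 1 \/ e = -1 ->
  `|triple_potential a B (jump y j e) - triple_potential a B y
    - 4 * e%:~R * spread y j| <= 4 + 4 * B.
Proof.
move=> B0 e1; have [k [l [jk jl kl]]] := other_two j.
rewrite !(triple_potentialE _ _ _ jk jl kl) /spread (sum_three _ jk jl kl).
rewrite !ffunE eqxx ![_ == j]eq_sym (negbTE jk) (negbTE jl) subrr add0r.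
have := quadratic_potential_step (y j - y k) B0 e1.
have := quadratic_potential_step (y j - y l) B0 e1.
rewrite ![y j + e - _]addrAC !ler_norml => /andP[? ?] /andP[? ?].
by apply/andP; split; lra.
Qed.

(** The squared spreads add up to three times the squared distances of the three
pairs, and the potential counts every pair twice. *)
Lemma spread_le a B (y : config 3) : 0 <= B ->
  \sum_j spread y j ^+ 2 <= 3 / 2 * (triple_potential a B y - a).
Proof.
move=> B0; have [k [l [jk jl kl]]] := other_two ord0.
rewrite (sum_three _ jk jl kl) (triple_potentialE _ _ _ jk jl kl) /spread.
rewrite !(sum_three _ jk jl kl) /quadratic_potential.
set u := if _ then _ else _; set v := if _ then _ else _; set w := if _ then _ else _.
have u0 : 0 <= u by rewrite /u; case: ifP => _; rewrite ?ler0z.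
have v0 : 0 <= v by rewrite /v; case: ifP => _; rewrite ?ler0z.
have w0 : 0 <= w by rewrite /w; case: ifP => _; rewrite ?ler0z.
rewrite !rmorphB/= -subr_ge0.
set A := (X in 0 <= X).
have -> : A = 3 * B * (u + v + w) by rewrite /A; field.
by rewrite !mulr_ge0 ?addr_ge0.
Qed.

Lemma triple_potential_clustered a B (y : config 3) : 0 <= B -> clustered 2 y ->
  triple_potential a B y <= a + 24 + 12 * B.
Proof.
move=> B0 cl; have [k [l [jk jl kl]]] := other_two ord0.
have q2 i j : quadratic_potential B (y i - y j) <= 4 + 2 * B.
  move/forallP: cl => /(_ i)/forallP/(_ j) yij.
  have yR : `|y i - y j|%:~R <= 2 :> R by rewrite (ler_int _ _ 2).
  rewrite /quadratic_potential lerD//.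
    have := yR; rewrite -real_normK ?num_real// intr_norm => yR'.
    have := normr_ge0 ((y i - y j)%:~R : R); nra.
  by rewrite mulrC ler_wpM2r//; case: ifP => _ //; lra.
rewrite (triple_potentialE _ _ _ jk jl kl).
have := q2 ord0 k; have := q2 ord0 l; have := q2 k l; lra.
Qed.

Lemma triple_potential_ge a B (y : config 3) : 0 <= B -> a <= triple_potential a B y.
Proof.
move=> B0; have := spread_le a y B0; rewrite -[in X in _ -> X]subr_ge0.
have : 0 <= \sum_j spread y j ^+ 2 by apply: sumr_ge0 => j _; rewrite sqr_ge0.
lra.
Qed.
End ThreeParticles.

(** * Three particles: a saturated subharmonic function *)

Section TripleLyapunov.
Context {R : realType}.
Implicit Types (m s B k : R).

(** The offset makes every increment of the potential at most a tenth of its value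
and absorbs the bounded terms of the squared increments. *)
Definition threshold B : R := 3000 + 2 * (4 + 4 * B) ^+ 2.

Lemma threshold_ge1 B : 1 <= threshold B.
Proof. by rewrite /threshold; have := sqr_ge0 (4 + 4 * B); lra. Qed.

(** An increment is [4 * spread] up to an error [d] of size [4 + 4 * B], and
[(4 v + d) ^ 2 <= 11 / 10 * 16 v ^ 2 + 11 d ^ 2]. *)
Lemma triple_potential_sqr_step B (y : config 3) j e (Q := triple_potential (threshold B) B) :
  0 <= B -> e = 1 \/ e = -1 ->
  (Q (jump y j e) - Q y) ^+ 2 <= 88 / 5 * spread y j ^+ 2 + 11 * (4 + 4 * B) ^+ 2.
Proof.
move=> B0 e1; have := triple_potential_step (threshold B) y j B0 e1; rewrite -/Q.
set x := Q _ - Q y; set D := 4 + 4 * B; set sg := spread y j => H.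
have e2 : e%:~R ^+ 2 = 1 :> R by case: e1 => ->; rewrite ?rmorphN ?sqrrN expr1n.
have dD : (x - 4 * e%:~R * sg) ^+ 2 <= D ^+ 2.
  rewrite -real_normK ?num_real// lerXn2r ?nnegrE//.
  by rewrite addr_ge0// mulr_ge0.
have -> : 88 / 5 * sg ^+ 2 = 88 / 5 * (e%:~R * sg) ^+ 2 by rewrite exprMn e2 mul1r.
move: dD; rewrite -mulrA; set v := e%:~R * sg; set d := x - _ => dD.
have -> : x = 4 * v + d by rewrite /d; ring.
have := sqr_ge0 (4 / 10 * v - d); nra.
Qed.

Lemma triple_potential_step_small B (y : config 3) j e
    (Q := triple_potential (threshold B) B) :
  0 <= B -> e = 1 \/ e = -1 -> `|Q (jump y j e) - Q y| <= Q y / 10.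
Proof.
move=> B0 e1; have := triple_potential_sqr_step y j B0 e1; rewrite -/Q.
have := spread_le (threshold B) y B0; rewrite -/Q.
have := triple_potential_ge (threshold B) y B0; rewrite -/Q => Qa.
have : spread y j ^+ 2 <= \sum_k spread y k ^+ 2 :> R.
  rewrite (bigD1 j)//= lerDl; apply: sumr_ge0 => k _; exact: sqr_ge0.
set S := \sum_k _; set D := (4 + 4 * B) ^+ 2; set x := Q _ - Q y; set q := Q y.
move=> H1 H2 H3.
have D0 : 0 <= D by rewrite sqr_ge0.
have aE : threshold B = 3000 + 2 * D by [].
have q3 : 3000 <= q by apply: le_trans Qa; rewrite aE; lra.
have : `|x| ^+ 2 <= (q / 10) ^+ 2.
  rewrite real_normK ?num_real//.
  have : x ^+ 2 <= 132 / 5 * q by lra.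
  nra.
by rewrite ler_pXn2r// ?nnegrE; lra.
Qed.

(** The squared increments are weighted by the full jump rates.  The random-walk
part has the size that it has for a planar walk, up to a factor [11 / 10]; the
inclusion part appears only with the number of neighbouring pairs, and is later
beaten by the [B] term of the drift. *)
Lemma triple_potential_gamma m B (y : config 3) (Q := triple_potential (threshold B) B) :
  0 < m -> 0 <= B ->
  \sum_(e <- [:: 1; -1] : seq int) \sum_(i < 3)
    (m / 2 + inclusion_rate y i e) * (Q (jump y i e) - Q y) ^+ 2 <=
  132 / 5 * (m + neighbour_pairs y) * Q y.
Proof.
move=> m0 B0; set D := (4 + 4 * B) ^+ 2; set S : R := \sum_k spread y k ^+ 2.
have D0 : 0 <= D by rewrite sqr_ge0.
have sS j : spread y j ^+ 2 <= S.
  rewrite /S (bigD1 j)//= lerDl; apply: sumr_ge0 => k _; exact: sqr_ge0.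
have N0 := neighbour_pairs_ge0 (R := R) y.
have S0 : 0 <= S by apply: sumr_ge0 => k _; exact: sqr_ge0.
pose W := 88 / 5 * S + 33 * D.
apply: (@le_trans _ _ ((m + neighbour_pairs y) * W)); last first.
  rewrite [132 / 5 * _]mulrC -mulrA ler_wpM2l ?addr_ge0 ?(ltW m0)//.
  have := spread_le (threshold B) y B0; rewrite -/Q -/S /W.
  have aE : threshold B = 3000 + 2 * D by [].
  lra.
have -> : (m + neighbour_pairs y) * W =
    \sum_(e <- [:: 1; -1] : seq int) (m / 2 * W + \sum_(i < 3) inclusion_rate y i e * W).
  rewrite big_split/= !big_cons !big_nil -!mulr_suml /neighbour_pairs !big_cons big_nil.
  by field.
rewrite big_seq [leRHS]big_seq; apply: ler_sum => e.
rewrite !inE => /orP eE.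
have {}eE : e = 1 \/ e = -1 by case: eE => /eqP; [left|right].
have -> : m / 2 * W = \sum_(j < 3) m / 2 * (88 / 5 * spread y j ^+ 2 + 11 * D).
  rewrite -mulr_sumr big_split/= -mulr_sumr -/S sumr_const card_ord.
  by rewrite -[_ *+ 3]mulr_natl /W; congr (_ * (_ + _)); ring.
rewrite -big_split/=; apply: ler_sum => j _; rewrite mulrDl.
have st := triple_potential_sqr_step y j B0 eE; rewrite -/Q -/D in st.
apply: lerD; first by rewrite ler_wpM2l// divr_ge0 ?(ltW m0).
rewrite ler_wpM2l ?inclusion_rate_ge0//; apply: le_trans st _.
have := sS j; rewrite /W; lra.
Qed.

Definition triple_lyapunov_fun B s (y : config 3) : R :=
  saturate s (fourth_root (triple_potential (threshold B) B y)).

(** The Taylor bound summed over all jumps: drift over [4 q] minus [k] times the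
squared increments over [q ^ 2].  The range of [r'] in the hypothesis on
[k] covers all fourth roots reachable in one jump. *)
Lemma triple_lyapunov_fun_lower m B s k (y : config 3)
    (q := triple_potential (threshold B) B y) (r := fourth_root q) :
  0 < m -> 0 <= B -> 0 < s ->
  (forall r', 97 / 100 * r <= r' -> 13 / 128 + r / (9 * (s + r')) <= k) ->
  s ^+ 2 * r / (s + r) ^+ 2 *
   ((12 * m + (B * m - 2) * neighbour_pairs y) / (4 * q)
     - k * (132 / 5 * (m + neighbour_pairs y)) / q)
  <= sip_generator m (triple_lyapunov_fun B s) y.
Proof.
move=> m0 B0 s0 kE.
pose Q := triple_potential (threshold B) B.
have q0 : 0 < q.
  by have := triple_potential_ge (threshold B) y B0; have := threshold_ge1 B; rewrite -/q; lra.
have r0 : 0 < r by exact: fourth_root_gt0.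
have r4 : r ^+ 4 = q by apply: fourth_rootK; exact: ltW.
have k0 : 0 <= k.
  apply: le_trans (kE r _); last by nra.
  by rewrite addr_ge0// divr_ge0 ?mulr_ge0 ?addr_ge0 ?ltW.
set w := s ^+ 2 * r / (s + r) ^+ 2.
have w0 : 0 <= w by rewrite /w divr_ge0 ?sqr_ge0// mulr_ge0 ?sqr_ge0// ltW.
have st j e : e = 1 \/ e = -1 ->
  w * ((Q (jump y j e) - Q y) / (4 * q) - k * (Q (jump y j e) - Q y) ^+ 2 / q ^+ 2)
  <= triple_lyapunov_fun B s (jump y j e) - triple_lyapunov_fun B s y.
  move=> eE; set dl := Q _ - Q y.
  have dq : `|dl| <= q / 10 := triple_potential_step_small y j B0 eE.
  pose x := dl / q.
  have xq : dl = x * q by rewrite /x divfK// gt_eqF.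
  have x1 : - (1 / 10) <= x.
    move: dq; rewrite ler_norml => /andP[dl1 _].
    by rewrite /x ler_pdivlMr//; lra.
  set q' := Q (jump y j e).
  have q'E : q' = q * (1 + x) by rewrite mulrDr mulr1 [q * x]mulrC -xq /dl addrC subrK.
  have q'0 : 0 < q' by rewrite q'E mulr_gt0//; lra.
  pose r' := fourth_root q'.
  have r'0 : 0 < r' by exact: fourth_root_gt0.
  have r'4 : r' ^+ 4 = r ^+ 4 * (1 + x) by rewrite r4 fourth_rootK ?ltW.
  have := saturate_fourth_root s0 r0 r'0 r'4 x1.
  apply: le_trans; rewrite -/w ler_wpM2l//.
  have -> : dl / (4 * q) = x / 4 by rewrite xq; field; rewrite gt_eqF.
  have -> : k * dl ^+ 2 / q ^+ 2 = k * x ^+ 2 by rewrite xq; field; rewrite gt_eqF.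
  rewrite lerD2l lerN2 ler_wpM2r ?sqr_ge0// kE//.
  have : 97 / 100 <= r' / r.
    apply: fourth_power_near1; first by rewrite divr_gt0.
    rewrite expr_div_n r'4 mulrAC divff ?mul1r; first by lra.
    by rewrite expf_neq0// gt_eqF.
  by rewrite ler_pdivlMr.
apply: (@le_trans _ _ (w * (sip_generator m Q y / (4 * q) - k / q ^+ 2 *
   \sum_(e <- [:: 1; -1] : seq int) \sum_(i < 3)
    (m / 2 + inclusion_rate y i e) * (Q (jump y i e) - Q y) ^+ 2))).
  rewrite ler_wpM2l// sip_generator_triple_potential lerD2l lerN2.
  have -> : k * (132 / 5 * (m + neighbour_pairs y)) / q =
     k / q ^+ 2 * (132 / 5 * (m + neighbour_pairs y) * q) by field; rewrite gt_eqF.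
  by rewrite ler_wpM2l ?divr_ge0 ?sqr_ge0// triple_potential_gamma.
rewrite mulr_suml mulr_sumr -sumrB mulr_sumr.
rewrite big_seq [leRHS]big_seq; apply: ler_sum => e.
rewrite !inE => /orP eE.
have {}eE : e = 1 \/ e = -1 by case: eE => /eqP; [left|right].
rewrite mulr_suml mulr_sumr -sumrB mulr_sumr; apply: ler_sum => j _.
have c0 : 0 <= m / 2 + inclusion_rate y j e.
  by rewrite addr_ge0 ?inclusion_rate_ge0// divr_ge0// ltW.
have := ler_wpM2l c0 (st j e eE); apply: le_trans.
by rewrite le_eqVlt; apply/orP; left; apply/eqP; ring.
Qed.

(** The function grows like the square root of the distance, up to [s].  At
distances much smaller than [s ^ 2] the drift wins over the second-order term;
at larger distances the loss is at most of order [s ^ -3].  For [s ^ 4 = T] the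
time that three particles spend close together up to time [T] is therefore at
most of order [s], which is much less than [sqrt T]. *)
Lemma triple_lyapunov m : 0 < m -> exists2 C : R, 0 < C & forall s, C <= s ->
  exists G : config 3 -> R, forall y, 0 <= G y <= C * s /\
    (clustered 2 y)%:R - C / s ^+ 3 <= sip_generator m G y.
Proof.
move=> m0; (* This value turns the coefficient [B * m - 2] of the neighbouring pairs
   into [12], the coefficient of [m]. *)
pose B := 14 / m.
have B0 : 0 <= B by rewrite divr_ge0// ltW.
pose q0 := threshold B + 24 + 12 * B.
have th1 := threshold_ge1 B.
have q01 : 1 <= q0 by rewrite /q0; lra.
have q00 : 0 < q0 by lra.
pose c := m / (20 * q0).
have c0 : 0 < c by rewrite divr_gt0//; lra.
have [K K0 KE] : exists2 K : R, 0 < K & K = 15 ^+ 3 by exists (15 ^+ 3).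
have key s y : 15 * q0 <= s ->
  c * (clustered 2 y)%:R - 24 * (m + 18) * K / s ^+ 3 <=
    sip_generator m (triple_lyapunov_fun B s) y.
  move=> sq; have s0 : 0 < s by lra.
  set q := triple_potential (threshold B) B y.
  have qth : threshold B <= q := triple_potential_ge _ _ B0.
  have q1 : 1 <= q by exact: le_trans qth.
  set r := fourth_root q.
  have r0 : 0 < r by apply: fourth_root_gt0; lra.
  have r4 : r ^+ 4 = q by apply: fourth_rootK; lra.
  have r1 : 1 <= r.
    rewrite leNgt; apply/negP => r1; suff : r ^+ 4 < 1 by rewrite r4; lra.
    by rewrite exprn_ilt1// ltW.
  have rq : r <= q by rewrite -r4 exprS ler_peMr ?(ltW r0)// exprn_ege1.
  set w := s ^+ 2 * r / (s + r) ^+ 2.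
  have sr0 : 0 < (s + r) ^+ 2 by rewrite exprn_gt0// addr_gt0.
  have wr : w <= r.
    rewrite /w ler_pdivrMr// mulrC ler_wpM2l ?(ltW r0)//.
    by rewrite lerXn2r ?nnegrE; lra.
  have w0 : 0 <= w by rewrite /w divr_ge0 ?sqr_ge0// mulr_ge0 ?sqr_ge0// ltW.
  have N0 := neighbour_pairs_ge0 (R := R) y; have N18 := neighbour_pairs_le (R := R) y.
  set N := neighbour_pairs y in N0 N18 *.
  have err0 : 0 <= 24 * (m + 18) * K / s ^+ 3.
    rewrite divr_ge0 ?exprn_ge0 ?(ltW s0)// mulr_ge0 ?(ltW K0)//; lra.
  have q0' : 0 < q by lra.
  have mN0 : 0 <= m + N by lra.
  have BmE : B * m = 14 by rewrite /B divfK// gt_eqF.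
  have lower k : (forall r', 97 / 100 * r <= r' -> 13 / 128 + r / (9 * (s + r')) <= k) ->
      w * ((m + N) / q * (3 - 132 / 5 * k)) <= sip_generator m (triple_lyapunov_fun B s) y.
    move=> /(triple_lyapunov_fun_lower m0 B0 s0); apply: le_trans.
    rewrite -/q -/r -/w -/N BmE.
    by rewrite le_eqVlt; apply/orP; left; apply/eqP; field; lra.
  (* Below [s / 15] saturation costs less than [1 / 128] in the second-order
     coefficient; above it, [q] is too large for a cluster. *)
  have [rs|rs] := leP r (s / 15).
    have kr r' : 97 / 100 * r <= r' -> 13 / 128 + r / (9 * (s + r')) <= 14 / 128.
      move=> rr'; have r'0 : 0 < r' by nra.
      rewrite -lerBrDl ler_pdivrMr ?mulr_gt0 ?addr_gt0//; lra.
    apply: le_trans (lower _ kr).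
    have wl : r / 2 <= w.
      have sr2 : (s + r) ^+ 2 <= 2 * s ^+ 2 by nra.
      rewrite /w ler_pdivlMr// -mulrA [s ^+ 2 * r]mulrC ler_wpM2l ?(ltW r0)//; lra.
    rewrite lerBlDr ler_wpDr//.
    have k3 : 1 / 10 <= 3 - 132 / 5 * (14 / 128) :> R by lra.
    have k30 : 0 <= 3 - 132 / 5 * (14 / 128) :> R by lra.
    case: (boolP (clustered 2 y)) => [cl|_]; last first.
      by rewrite mulr0 mulr_ge0// mulr_ge0// divr_ge0// ltW.
    rewrite mulr1.
    have qq0 : q <= q0 := triple_potential_clustered _ B0 cl.
    have a1 : 1 / 2 <= w by apply: le_trans wl; rewrite ler_wpM2r.
    have a2 : m / q0 <= (m + N) / q.
      by rewrite ler_pM ?invr_ge0 ?(ltW m0) ?(ltW q00) ?lerDl// lef_pV2 ?posrE.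
    have a3 : 0 <= m / q0 by rewrite divr_ge0 ?(ltW m0) ?(ltW q00).
    have -> : c = 1 / 2 * (m / q0 * (1 / 10)) by rewrite /c; field; rewrite gt_eqF.
    by apply: ler_pM => //; [exact: mulr_ge0|exact: ler_pM].
  have -> : clustered 2 y = false.
    apply/negP => cl; have := triple_potential_clustered (threshold B) B0 cl.
    rewrite -/q -/q0; lra.
  have kr r' : 97 / 100 * r <= r' -> 13 / 128 + r / (9 * (s + r')) <= 1.
    move=> rr'.
    have : r / (9 * (s + r')) <= 1 / 2 by rewrite ler_pdivrMr; nra.
    lra.
  apply: le_trans (lower _ kr); rewrite mulr0 sub0r.
  have -> : w * ((m + N) / q * (3 - 132 / 5 * 1)) =
    - (117 / 5 * ((m + N) * (w / q))) by field; lra.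
  have wq0 : 0 <= w / q by rewrite divr_ge0// ltW.
  have wqs : w / q <= K / s ^+ 3.
    have -> : K / s ^+ 3 = ((s / 15) ^+ 3)^-1 by rewrite KE; field; rewrite gt_eqF.
    apply: (@le_trans _ _ (r ^+ 3)^-1).
      rewrite ler_pdivrMr// (_ : _ * q = r)//.
      by rewrite -r4; field; rewrite gt_eqF.
    rewrite lef_pV2 ?posrE ?exprn_gt0 ?divr_gt0//.
    by rewrite lerXn2r ?nnegrE ?(ltW rs) ?(ltW r0)// divr_ge0 ?(ltW s0).
  have N18' : m + N <= m + 18 by lra.
  have -> : 24 * (m + 18) * K / s ^+ 3 = 24 * ((m + 18) * (K / s ^+ 3)).
    by rewrite !mulrA.
  rewrite lerN2; apply: ler_pM => //; [exact: mulr_ge0|lra|].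
  exact: ler_pM.
pose C := 15 * q0 + c^-1 + 24 * (m + 18) * K / c.
have t1 : 0 < c^-1 by rewrite invr_gt0.
have t2 : 0 <= 24 * (m + 18) * K / c.
  by rewrite divr_ge0 ?(ltW c0)// mulr_ge0 ?(ltW K0)//; lra.
exists C; first by rewrite /C; lra.
move=> s sC; exists (fun y => c^-1 * triple_lyapunov_fun B s y) => y.
have s15 : 15 * q0 <= s by apply: le_trans sC; rewrite /C; lra.
have s0 : 0 < s by lra.
split.
  have r0 : 0 <= fourth_root (triple_potential (threshold B) B y) by rewrite sqrtr_ge0.
  have g0 := saturate_ge0 s0 r0; have gs := saturate_le s0 r0.
  rewrite mulr_ge0 ?(ltW t1)//=.
  by rewrite ler_pM ?(ltW t1)// /C; lra.
rewrite sip_generatorZ; have := ler_wpM2l (ltW t1) (key s y s15); apply: le_trans.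
rewrite mulrBr mulKf ?gt_eqF// lerD2l lerN2.
rewrite mulrA [c^-1 * _]mulrC ler_wpM2r ?invr_ge0 ?exprn_ge0 ?(ltW s0)//.
by rewrite /C; lra.
Qed.
End TripleLyapunov.

(** * Clusters of particles *)

Section Displacement.
Context {R : realType}.
Implicit Types (m : R) (z e : int).

Definition clusters q n (r : int) (y : config n) : R :=
  \sum_(s : {ffun 'I_q -> 'I_n} | injectiveb s) (clustered r (subconfig y s))%:R.

Lemma clusters_ge0 q n r (y : config n) : 0 <= clusters q r y.
Proof. exact: sumr_ge0. Qed.

Lemma clustered_le_clusters q n r (y : config n) (s : {ffun 'I_q -> 'I_n}) :
  injective s -> (clustered r (subconfig y s))%:R <= clusters q r y.
Proof.
move=> /injectiveP sI; rewrite /clusters (bigD1 s)//= lerDl.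
exact: sumr_ge0.
Qed.

(** The number of maps from ['I_q] to ['I_n] serves as a crude bound for the number
of labellings. *)
Lemma lift_lyapunov n q m (G : config q -> R) (r : int) (A b : R) :
  (forall y, 0 <= G y <= A /\ (clustered r y)%:R - b <= sip_generator m G y) ->
  exists F : config n -> R, forall y,
    0 <= F y <= #|{ffun 'I_q -> 'I_n}|%:R * A /\
    clusters q r y - #|{ffun 'I_q -> 'I_n}|%:R * `|b| <= sip_generator m F y.
Proof.
move=> GA.
pose N : R := \sum_(s : {ffun 'I_q -> 'I_n} | injectiveb s) 1.
have N_le (x : R) : 0 <= x -> N * x <= #|{ffun 'I_q -> 'I_n}|%:R * x.
  move=> x0; rewrite ler_wpM2r// /N sumr_const ler_nat; exact: max_card.
exists (fun y => \sum_(s : {ffun 'I_q -> 'I_n} | injectiveb s) G (subconfig y s)) => y.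
split.
  apply/andP; split.
    by apply: sumr_ge0 => s _; have [/andP[]] := GA (subconfig y s).
  have A0 : 0 <= A.
    by have [/andP[G0 /(le_trans G0)]] := GA [ffun=> 0].
  apply: le_trans (N_le _ A0); rewrite mulr_suml; apply: ler_sum => s _.
  by rewrite mul1r; have [/andP[]] := GA (subconfig y s).
rewrite sip_generator_consistent.
apply: (@le_trans _ _ (clusters q r y - N * `|b|)).
  by rewrite lerD2l lerN2 N_le.
rewrite mulr_suml -sumrB; apply: ler_sum => s _; rewrite mul1r.
have [_] := GA (subconfig y s); apply: le_trans.
by rewrite lerD2l lerN2 ler_norm.
Qed.

(** * The corrected displacement *)

Definition sign z : R := (Num.sg z)%:~R.

Lemma sign_step z e : e = 1 \/ e = -1 ->
  `|sign (z + e) - sign z| <= (`|z| <= 1)%R%:R.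
Proof.
move=> e1; rewrite /sign -rmorphB/= -intr_norm.
have : `|Num.sg (z + e) - Num.sg z| <= (`|z| <= 1)%R%:Z.
  case: e1 => ->; lia.
by rewrite -(ler_int R); case: (`|z| <= 1)%R.
Qed.

Definition pair_of n (k i : 'I_n) : {ffun 'I_2 -> 'I_n} :=
  [ffun a => if a == ord0 then k else i].

Lemma pair_of_inj n (k i : 'I_n) : k != i -> injective (pair_of k i).
Proof.
move=> ki a b; rewrite !ffunE.
case: eqP => [->|/eqP a0]; case: eqP => [->|/eqP b0]//.
- by move=> kE; rewrite kE eqxx in ki.
- by move=> kE; rewrite kE eqxx in ki.
by move=> _; apply/val_inj; case: a a0 => -[|[|]]//; case: b b0 => -[|[|]].
Qed.

Definition triple_of n (k i l : 'I_n) : {ffun 'I_3 -> 'I_n} :=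
  [ffun a : 'I_3 => if val a == 0%N then k else if val a == 1%N then i else l].

Lemma triple_of_inj n (k i l : 'I_n) : k != i -> k != l -> i != l ->
  injective (triple_of k i l).
Proof.
move=> ki kl il a b; rewrite !ffunE.
case: a => -[|[|[|//]]] a3; case: b => -[|[|[|//]]] b3 /= E;
  try exact/val_inj; by move: ki kl il; rewrite E ?eqxx.
Qed.

Lemma clusters3_ge1 n (y : config n) (k i l : 'I_n) :
  k != i -> k != l -> i != l ->
  `|y k - y i| <= 1 -> `|y l - y k| = 1 \/ `|y l - y i| = 1 ->
  1 <= clusters 3 2 y.
Proof.
move=> ki kl il yki yl.
have := clustered_le_clusters 2 y (triple_of_inj ki kl il).
rewrite (_ : clustered _ _)//; apply/forallP => a; apply/forallP => b.
rewrite !ffunE.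
by case: a => -[|[|[|//]]] a3; case: b => -[|[|[|//]]] b3 /=; lia.
Qed.

Lemma clusters2_ge1 n (y : config n) (k i : 'I_n) :
  k != i -> `|y k - y i| <= 1 -> 1 <= clusters 2 1 y.
Proof.
move=> ki yki; have := clustered_le_clusters 1 y (pair_of_inj ki).
rewrite (_ : clustered _ _)//; apply/forallP => a; apply/forallP => b.
by rewrite !ffunE; do 2 case: ifP => _; lia.
Qed.

(** For two particles the sign is mapped exactly to the expression with [m + 2].
The remaining inclusion jumps change the sign only if the pair is at distance at
most one, and then the particle that causes the jump completes a cluster of
three. *)
Lemma sip_generator_sign n m (y : config n) (k i : 'I_n) : k != i ->
  `|sip_generator m (fun y => sign (y k - y i)) y +
    (m + 2) * ((y k == y i + 1)%:R - (y k == y i - 1)%:R)| <=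
  4 * n%:R * clusters 3 2 y.
Proof.
move=> ki.
have -> : sip_generator m (fun y => sign (y k - y i)) y =
    sip_generator m (fun y => pair_function sign (subconfig y (pair_of k i))) y.
  by congr sip_generator; apply/funext => x; rewrite /pair_function !ffunE.
rewrite sip_generator_subconfig; last exact: pair_of_inj.
rewrite sip_generator_pair !ffunE/=.
have -> : (y k == y i + 1) = (y k - y i == 1) by lia.
have -> : (y k == y i - 1) = (y k - y i == -1) by lia.
set z := y k - y i.
have -> : m * (sign (z + 1) + sign (z - 1) - 2 * sign z) +
    2 * ((z == 1)%:R * (sign 0 - sign 1) + (z == -1)%:R * (sign 0 - sign (-1))) =
    - ((m + 2) * ((z == 1)%:R - (z == -1)%:R)).
  have -> : sign 0 = 0 by rewrite /sign sgr0.
  have -> : sign 1 = 1 by rewrite /sign sgr1.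
  have -> : sign (-1) = -1 by rewrite /sign sgrN1 rmorphN.
  have -> : sign (z + 1) + sign (z - 1) - 2 * sign z = (z == -1)%:R - (z == 1)%:R.
    have : Num.sg (z + 1) + Num.sg (z - 1) - 2 * Num.sg z =
        (z == -1)%:Z - (z == 1)%:Z by clear; lia.
    move=> /(congr1 (fun x : int => x%:~R : R)).
    by rewrite !(rmorphB, rmorphD, rmorphM)/=.
  by ring.
rewrite addrAC addNr add0r.
set s := pair_of k i; set C := clusters 3 2 y.
have C0 : 0 <= C by exact: clusters_ge0.
have bound e a : e \in [:: 1; -1] ->
    `|(\sum_(l | l \notin codom s) (y l == y (s a) + e)%:R) *
      (pair_function sign (jump (subconfig y s) a e) -
       pair_function sign (subconfig y s))| <= n%:R * C.
  rewrite !inE => /orP eE; have {}eE : e = 1 \/ e = -1.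
    by case: eE => /eqP ->; [left|right].
  have eN : - e = 1 \/ - e = -1 by case: eE => ->; [right|left].
  have a01 : a = ord0 \/ a = ord_max.
    by case: a => -[|[|//]] c2; [left|right]; exact/val_inj.
  set D := pair_function _ _ - _.
  have DE : `|D| <= (`|z| <= 1)%R%:R.
    rewrite /D /pair_function !ffunE; case: a01 => -> /=.
      by rewrite addrAC; exact: sign_step.
    by rewrite opprD addrA; exact: sign_step.
  rewrite mulr_suml; apply: le_trans (ler_norm_sum _ _ _) _.
  apply: (@le_trans _ _ (\sum_(l < n) C)); last first.
    by rewrite sumr_const card_ord -[leLHS]mulr_natl.
  rewrite big_mkcond/=; apply: ler_sum => l _; case: ifPn => // ls.
  rewrite normrM normr_nat; case: eqP => [yl|_]; last by rewrite mul0r.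
  rewrite mul1r; apply: le_trans DE _.
  have [z1|//] := boolP (`|z| <= 1)%R.
  apply: (clusters3_ge1 ki (l := l)) => //.
  - by apply: contraNneq ls => <-; apply/codomP; exists ord0; rewrite !ffunE.
  - by apply: contraNneq ls => <-; apply/codomP; exists ord_max; rewrite !ffunE.
  - move: yl; rewrite /s !ffunE; clear -a01 eE.
    by case: a01 => -> /=; case: eE => ->; lia.
apply: le_trans (ler_norm_sum _ _ _) _; rewrite big_seq.
apply: (@le_trans _ _ (\sum_(e <- [:: 1; -1] : seq int) 2 * (n%:R * C))); last first.
  by rewrite !big_cons big_nil; lra.
rewrite [leRHS]big_seq; apply: ler_sum => e eE.
apply: le_trans (ler_norm_sum _ _ _) _.
apply: (@le_trans _ _ (\sum_(a < 2) n%:R * C)).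
  by apply: ler_sum => a _; exact: bound.
by rewrite sumr_const card_ord -[leLHS]mulr_natl.
Qed.

Section CorrectedGap.
Context (n : nat) (m : R) (i : 'I_n).

Definition order_sum (y : config n) : R := \sum_(k | k != i) sign (y k - y i).

(** The displacement plus the bounded corrector that cancels the drift caused by
the neighbours of particle [i]. *)
Definition corrected_gap (z : coupled_state n) : R :=
  (z.1 i - z.2 i)%:~R + (m + 2)^-1 * order_sum z.1.

Lemma order_sum_le (y : config n) : `|order_sum y| <= n%:R.
Proof.
rewrite /order_sum; apply: le_trans (ler_norm_sum _ _ _) _.
apply: (@le_trans _ _ (\sum_(k < n) 1)); last by rewrite sumr_const card_ord.
rewrite big_mkcond/=; apply: ler_sum => k _; case: ifP => // _.
by rewrite /sign -intr_norm -[1]/(1%:~R) ler_int; lia.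
Qed.

Lemma corrected_gap_dist (z : coupled_state n) : 0 < m ->
  `|corrected_gap z - (z.1 i - z.2 i)%:~R| <= n%:R.
Proof.
move=> m0; rewrite /corrected_gap addrC addrA addNr add0r normrM.
apply: le_trans (order_sum_le z.1); rewrite ler_piMl//.
by rewrite ger0_norm ?invr_ge0 ?invf_le1; lra.
Qed.

(** Joint jumps cancel, so only inclusion jumps of particle [i] contribute. *)
Lemma gap_generator (z : coupled_state n) :
  coupling_generator m (fun z : coupled_state n => (z.1 i - z.2 i)%:~R) z =
  \sum_(k | k != i) ((z.1 k == z.1 i + 1)%:R - (z.1 k == z.1 i - 1)%:R).
Proof.
case: z => y y'; rewrite /coupling_generator /=.
rewrite [X in X + _]big1 ?add0r; last first.
  move=> e _; rewrite big1// => j _; rewrite !ffunE.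
  case: eqP => [->|_]; last by rewrite subrr mulr0.
  by rewrite opprD addrACA subrr addr0 subrr mulr0.
have inner e : \sum_(j < n) \sum_(k < n) (y k == y j + e)%:R *
    ((jump y j e i - y' i)%:~R - (y i - y' i)%:~R) =
    \sum_(k < n) (y k == y i + e)%:R * e%:~R :> R.
  rewrite (bigD1 i)//= [X in _ + X]big1 ?addr0; last first.
    move=> j ji; rewrite big1// => k _; rewrite ffunE [i == j]eq_sym (negbTE ji).
    by rewrite subrr mulr0.
  apply: eq_bigr => k _; rewrite ffunE eqxx -rmorphB/=; congr (_ * _%:~R); ring.
rewrite !big_cons big_nil addr0 !inner -big_split/= (bigD1 i)//=.
have -> : (y i == y i + 1) = false by lia.
have -> : (y i == y i - 1) = false by lia.
rewrite !mul0r !add0r; apply: eq_bigr => k _.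
by rewrite rmorphN/= mulr1 mulrN1.
Qed.

(** The two-body parts of the drifts of the displacement and of the corrector
cancel exactly. *)
Lemma corrected_gap_drift (z : coupled_state n) : 0 < m ->
  `|coupling_generator m corrected_gap z| <=
  (m + 2)^-1 * (4 * n%:R ^+ 2) * clusters 3 2 z.1.
Proof.
move=> m0; rewrite /corrected_gap.
rewrite (coupling_generatorD m (fun z : coupled_state n => (z.1 i - z.2 i)%:~R)
  (fun z : coupled_state n => (m + 2)^-1 * order_sum z.1)).
rewrite coupling_generatorZ (coupling_generator_fst m order_sum) gap_generator.
rewrite /order_sum (sip_generator_sum m (fun k => k != i) (fun k y => sign (y k - y i))).
have m20 : 0 < m + 2 by lra.
set y := z.1.
pose D k : R := (y k == y i + 1)%:R - (y k == y i - 1)%:R.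
have -> : \sum_(k | k != i) D k + (m + 2)^-1 *
     (\sum_(k | k != i) sip_generator m (fun y => sign (y k - y i)) y) =
   (m + 2)^-1 * \sum_(k | k != i) (sip_generator m (fun y => sign (y k - y i)) y
      + (m + 2) * D k).
  by rewrite [X in _ = _ * X]big_split/= mulrDr -[X in _ = _ + _ * X]mulr_sumr mulKf ?gt_eqF// addrC.
rewrite normrM gtr0_norm ?invr_gt0// -mulrA ler_wpM2l ?invr_ge0 ?(ltW m20)//.
apply: le_trans (ler_norm_sum _ _ _) _.
set C := clusters 3 2 y; have C0 : 0 <= C by exact: clusters_ge0.
apply: (@le_trans _ _ (\sum_(k < n) 4 * n%:R * C)).
  rewrite big_mkcond/=; apply: ler_sum => k _; case: ifPn => ki; first exact: sip_generator_sign.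
  by rewrite !mulr_ge0.
by rewrite sumr_const card_ord -[leLHS]mulr_natl le_eqVlt; apply/orP; left; apply/eqP; ring.
Qed.

Lemma order_sum_step (y : config n) j e : e = 1 \/ e = -1 ->
  `|order_sum (jump y j e) - order_sum y| <= n%:R * (clusters 2 1 y != 0)%:R.
Proof.
move=> eE; have eN : - e = 1 \/ - e = -1 by case: eE => ->; [right|left].
rewrite /order_sum -sumrB; apply: le_trans (ler_norm_sum _ _ _) _.
apply: (@le_trans _ _ (\sum_(k < n) (clusters 2 1 y != 0)%:R)); last first.
  by rewrite sumr_const card_ord -[leLHS]mulr_natl.
rewrite big_mkcond/=; apply: ler_sum => k _; case: ifPn => // ki.
apply: (@le_trans _ _ (`|y k - y i| <= 1)%R%:R).
  rewrite !ffunE; case: (eqVneq k j) => [kj|_].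
    rewrite (_ : (i == j) = false); last by rewrite -kj eq_sym (negbTE ki).
    by rewrite addrAC; exact: sign_step.
  case: eqP => [_|_]; last by rewrite subrr normr0.
  by rewrite opprD addrA; exact: sign_step.
have [yki|//] := boolP (`|y k - y i| <= 1)%R.
by have := clusters2_ge1 ki yki; case: eqP => // ->; rewrite ler10.
Qed.

Definition gap_constant : R :=
  2 * n%:R * (m / 2 + n%:R) * (1 + (m + 2)^-1 * n%:R) ^+ 2.

(** Applied at [z] to [(h - h z) ^ 2], the generator yields the sum of the squared
increments of [h] weighted by the rates.  A random-walk jump changes [h] only
through a sign, an inclusion jump requires a neighbour: both need a close pair,
and every increment is bounded. *)
Lemma corrected_gap_variance (z : coupled_state n) : 0 < m ->
  coupling_generator m (fun z' : coupled_state n => (corrected_gap z' - corrected_gap z) ^+ 2) z <=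
  gap_constant * clusters 2 1 z.1.
Proof.
case: z => y y' m0.
have m20 : 0 < m + 2 by lra.
have th0 : 0 <= (m + 2)^-1 by rewrite invr_ge0 ltW.
set b := 1 + (m + 2)^-1 * n%:R.
pose x : R := (clusters 2 1 y != 0)%:R.
have x0 : 0 <= x by rewrite /x ler0n.
have xx : x ^+ 2 <= clusters 2 1 y.
  rewrite /x; case: (eqVneq (clusters 2 1 y) 0) => [->|c0]; first by rewrite expr0n.
  rewrite expr1n.
  have : exists s : {ffun 'I_2 -> 'I_n}, injectiveb s && clustered 1 (subconfig y s).
    apply/existsP; apply: contraNT c0 => /existsPn h.
    rewrite /clusters big1// => s sI; have := h s; rewrite sI/=.
    by move=> /negbTE ->.
  move=> [s /andP[/injectiveP sI sc]].
  by have := clustered_le_clusters 1 y sI; rewrite sc.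
have b1 : 1 <= b by rewrite /b lerDl mulr_ge0.
have sq d : `|d| <= b * x -> d ^+ 2 <= b ^+ 2 * clusters 2 1 y.
  move=> db; rewrite -real_normK ?num_real//.
  apply: le_trans (lerXn2r 2 _ _ db) _; rewrite ?nnegrE ?mulr_ge0//; first lra.
  by rewrite exprMn ler_wpM2l ?sqr_ge0.
have stepS j e : e = 1 \/ e = -1 ->
    `|(m + 2)^-1 * (order_sum (jump y j e) - order_sum y)| <= (b - 1) * x.
  move=> eE; rewrite normrM ger0_norm// /b [1 + _]addrC addrK -mulrA.
  by rewrite ler_wpM2l// order_sum_step.
set V := b ^+ 2 * clusters 2 1 y.
have V0 : 0 <= V by rewrite mulr_ge0 ?sqr_ge0 ?clusters_ge0.
have rw j e : e = 1 \/ e = -1 ->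
  (corrected_gap (jump y j e, jump y' j e) - corrected_gap (y, y')) ^+ 2 <= V.
  move=> eE; apply: sq; rewrite /corrected_gap /= !ffunE.
  have -> : (if i == j then y i + e else y i) - (if i == j then y' i + e else y' i)
     = y i - y' i by case: eqP => _ //; rewrite opprD addrACA subrr addr0.
  rewrite opprD addrACA subrr add0r -mulrBr; apply: le_trans (stepS j e eE) _.
  by rewrite ler_wpM2r// lerBlDr lerDl.
have inc j e k : e = 1 \/ e = -1 -> y k == y j + e ->
  (corrected_gap (jump y j e, y') - corrected_gap (y, y')) ^+ 2 <= V.
  move=> eE /eqP yk; apply: sq; rewrite /corrected_gap /= opprD addrACA -mulrBr.
  apply: le_trans (ler_normD _ _) _.
  have -> : b * x = x + (b - 1) * x by ring.
  rewrite lerD ?stepS// ffunE; case: eqP => [ij|_]; last by rewrite subrr normr0.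
  have ki : k != i.
    by apply/eqP => ki; move: yk; rewrite ki ij; clear -eE; case: eE => ->; lia.
  rewrite -rmorphB/= (_ : y i + e - y' i - (y i - y' i) = e); last by ring.
  have yki : `|y k - y i| <= 1 by move: yk; rewrite -ij; clear -eE; case: eE => ->; lia.
  have : clusters 2 1 y != 0.
    by have := clusters2_ge1 ki yki; case: eqP => // ->; rewrite ler10.
  rewrite /x => ->; case: eE => ->; first by rewrite normr1.
  by rewrite rmorphN normrN normr1.
rewrite /coupling_generator /= subrr expr0n/=.
have -> : gap_constant * clusters 2 1 y =
   2 * (n%:R * (m / 2 * V)) + 2 * (n%:R * (n%:R * V)).
  by rewrite /gap_constant /V -/b; ring.
have pm (e : int) : e \in [:: 1; -1] -> e = 1 \/ e = -1.
  by rewrite !inE => /orP[] /eqP ->; [left|right].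
have sum2 (F : int -> R) K : (forall e, e = 1 \/ e = -1 -> F e <= K) ->
    \sum_(e <- [:: 1; -1] : seq int) F e <= 2 * K.
  move=> FK; rewrite !big_cons big_nil addr0.
  have := FK 1 (or_introl erefl); have := FK (-1) (or_intror erefl); lra.
have sum_le (F : 'I_n -> R) K : (forall j, F j <= K) -> \sum_(j < n) F j <= n%:R * K.
  move=> FK; apply: (@le_trans _ _ (\sum_(j < n) K)); first exact: ler_sum.
  by rewrite sumr_const card_ord -[leLHS]mulr_natl.
apply: lerD; apply: sum2 => e eE; apply: (sum_le) => j.
  by rewrite subr0 ler_wpM2l ?rw// divr_ge0 ?(ltW m0).
apply: sum_le => k; case: eqP => [/eqP yk|_]; last by rewrite mul0r.
by rewrite mul1r subr0; exact: inc yk.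
Qed.

End CorrectedGap.
End Displacement.

(** * The test function *)

Section TestFunction.
Context {R : realType}.
Implicit Types (m s T v w : R) (n : nat).

(** A bounded version of [v ^ 2 / T]; boundedness makes it an admissible argument of
the generator. *)
Definition rational_square T v : R := v ^+ 2 / (T + v ^+ 2).

Lemma rational_square_ge0 T v : 0 < T -> 0 <= rational_square T v.
Proof. by move=> T0; rewrite divr_ge0 ?addr_ge0 ?sqr_ge0// ltW. Qed.

Lemma rational_square_le1 T v : 0 < T -> rational_square T v <= 1.
Proof.
move=> T0; have v2 := sqr_ge0 v.
by rewrite ler_pdivrMr ?mul1r ?lerDr ?(ltW T0)// ltr_pwDl.
Qed.

(** The second derivative is at most [2 / T] everywhere, which makes the quadratic
upper bound global. *)
Lemma rational_square_taylor T v w : 0 < T ->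
  rational_square T w - rational_square T v <=
  2 * v * T / (T + v ^+ 2) ^+ 2 * (w - v) + (w - v) ^+ 2 / T.
Proof.
move=> T0; have v2 := sqr_ge0 v; have w2 := sqr_ge0 w.
have A0 : 0 < T + v ^+ 2 by lra.
have B0 : 0 < T + w ^+ 2 by lra.
rewrite -subr_ge0 /rational_square.
have -> : 2 * v * T / (T + v ^+ 2) ^+ 2 * (w - v) + (w - v) ^+ 2 / T -
    (w ^+ 2 / (T + w ^+ 2) - v ^+ 2 / (T + v ^+ 2)) =
    (w - v) ^+ 2 / (T * (T + v ^+ 2) ^+ 2 * (T + w ^+ 2)) *
    ((T + v ^+ 2) ^+ 2 * (T + w ^+ 2) - T ^+ 2 * (T - v ^+ 2 - 2 * v * w)).
  by field; rewrite !gt_eqF.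
rewrite mulr_ge0//.
  by rewrite divr_ge0 ?sqr_ge0// !mulr_ge0 ?sqr_ge0 ?ltW.
have h1 : T - v ^+ 2 - 2 * v * w <= T + w ^+ 2 by have := sqr_ge0 (v + w); nra.
have h2 : T ^+ 2 <= (T + v ^+ 2) ^+ 2 by nra.
rewrite subr_ge0; apply: (@le_trans _ _ (T ^+ 2 * (T + w ^+ 2))).
  by rewrite ler_wpM2l ?sqr_ge0.
by rewrite ler_wpM2r// ltW.
Qed.

Lemma rational_square_slope s v : 0 < s ->
  `|2 * v * s ^+ 4 / (s ^+ 4 + v ^+ 2) ^+ 2| <= (s ^+ 2)^-1.
Proof.
move=> s0; have s2 : 0 < s ^+ 2 by rewrite exprn_gt0.
rewrite (exprM _ 2 2); set S := s ^+ 2 in s2 *.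
have S2 : 0 < S ^+ 2 by rewrite exprn_gt0.
have v2 := sqr_ge0 v.
have A0 : 0 < S ^+ 2 + v ^+ 2 by lra.
rewrite normrM normfV (ger0_norm (sqr_ge0 (S ^+ 2 + v ^+ 2))).
rewrite normrM (gtr0_norm S2) normrM normr_nat.
rewrite ler_pdivrMr ?exprn_gt0// ler_pdivlMl//.
have av : 2 * S * `|v| <= S ^+ 2 + v ^+ 2.
  rewrite -(real_normK (num_real v)); have := sqr_ge0 (S - `|v|); nra.
have -> : S * (2 * `|v| * S ^+ 2) = (2 * S * `|v|) * S ^+ 2 by ring.
rewrite [leRHS]expr2; apply: ler_pM => //; first by rewrite !mulr_ge0// ltW.
  exact: ltW.
by rewrite lerDl.
Qed.

Lemma gap_test_generator m n (i : 'I_n) : 0 < m ->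
  exists2 C : R, 0 < C & forall s (z : coupled_state n), 0 < s ->
    coupling_generator m
      (fun z => rational_square (s ^+ 4) (corrected_gap m i z)) z <=
    C / s ^+ 2 * clusters 3 2 z.1 + C / s ^+ 4 * clusters 2 1 z.1.
Proof.
move=> m0; pose C1 : R := (m + 2)^-1 * (4 * n%:R ^+ 2).
have C10 : 0 <= C1 by rewrite !mulr_ge0 ?invr_ge0 ?exprn_ge0//; lra.
have C20 : 0 <= gap_constant n m.
  rewrite /gap_constant !mulr_ge0 ?exprn_ge0 ?addr_ge0 ?mulr_ge0 ?invr_ge0 ?divr_ge0//; lra.
exists (1 + C1 + gap_constant n m); first by lra.
set C := 1 + _ + _; move=> s z s0.
have T0 : 0 < s ^+ 4 by rewrite exprn_gt0.
have s20 : 0 < s ^+ 2 by rewrite exprn_gt0.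
pose h := corrected_gap (n := n) m i.
pose a := 2 * h z * s ^+ 4 / (s ^+ 4 + h z ^+ 2) ^+ 2.
apply: (@le_trans _ _ (coupling_generator m
  (fun z' => a * h z' + (s ^+ 4)^-1 * (h z' - h z) ^+ 2) z)).
  apply: coupling_generator_le; first exact: ltW.
  move=> z'; apply: le_trans (rational_square_taylor _ _ T0) _.
  by rewrite -/h -/a subrr expr0n/= mulr0 addr0 mulrBr [_ / s ^+ 4]mulrC addrAC.
rewrite (coupling_generatorD m (fun z' => a * h z')
  (fun z' => (s ^+ 4)^-1 * (h z' - h z) ^+ 2)) !coupling_generatorZ.
have c30 := clusters_ge0 (R := R) 3 2 z.1; have c20 := clusters_ge0 (R := R) 2 1 z.1.
apply: lerD.
  apply: le_trans (ler_norm _) _; rewrite normrM.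
  rewrite [C / _]mulrC -mulrA; apply: ler_pM => //.
    exact: rational_square_slope.
  apply: le_trans (corrected_gap_drift i z m0) _.
  by rewrite ler_wpM2r// /C -/C1; lra.
rewrite [C / _]mulrC -mulrA ler_wpM2l ?invr_ge0 ?(ltW T0)//.
apply: le_trans (corrected_gap_variance i z m0) _.
by rewrite ler_wpM2r// /C; lra.
Qed.

(** Subtract from the bounded square the multiples of the lifted Lyapunov functions
that cancel the two cluster terms.  They are of sizes [s / s ^ 2] and
[s / s ^ 4], hence negligible, and leave an error of order [s ^ -5], which remains
negligible after multiplication by the time [s ^ 4]. *)
Lemma gap_test_function m n (i : 'I_n) : 0 < m ->
  exists2 C : R, 1 <= C & forall s, C <= s ->
    exists f : coupled_state n -> R, forall z,
      let phi := rational_square (s ^+ 4) (corrected_gap m i z) in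
      phi - C / s <= f z <= phi /\ coupling_generator m f z <= C / s ^+ 5.
Proof.
move=> m0; have [C1 C10 phiL] := gap_test_generator i m0.
have [C2 C20 pairL] := pair_lyapunov m0.
have [C3 C30 tripleL] := triple_lyapunov m0.
pose K2 : R := #|{ffun 'I_2 -> 'I_n}|%:R.
pose K3 : R := #|{ffun 'I_3 -> 'I_n}|%:R.
have K20 : 0 <= K2 by rewrite ler0n.
have K30 : 0 <= K3 by rewrite ler0n.
pose D := C1 * (K3 * C3) + C1 * (K2 * C2).
have D30 : 0 <= C1 * (K3 * C3) by rewrite !mulr_ge0// ltW.
have D20 : 0 <= C1 * (K2 * C2) by rewrite !mulr_ge0// ltW.
exists (4 + C3 + D); first by rewrite /D; lra.
set C := 4 + C3 + D; move=> s sC.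
have s4 : 4 <= s by apply: le_trans sC; rewrite /C /D; lra.
have sC3 : C3 <= s by apply: le_trans sC; rewrite /C /D; lra.
have s0 : 0 < s by lra.
have DC : D <= C by rewrite /C; lra.
have [G2 G2P] := pairL s s4; have [F2 F2P] := lift_lyapunov n G2P.
have [G3 G3P] := tripleL s sC3; have [F3 F3P] := lift_lyapunov n G3P.
exists (fun z => rational_square (s ^+ 4) (corrected_gap m i z) +
  (- (C1 / s ^+ 2) * F3 z.1 + - (C1 / s ^+ 4) * F2 z.1)) => z.
have [/andP[F20 F2l] F2L] := F2P z.1; have [/andP[F30 F3l] F3L] := F3P z.1.
rewrite -/K2 in F2l F2L; rewrite -/K3 in F3l F3L.
have a3 : 0 <= C1 / s ^+ 2 by rewrite divr_ge0 ?exprn_ge0 ?ltW.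
have a2 : 0 <= C1 / s ^+ 4 by rewrite divr_ge0 ?exprn_ge0 ?ltW.
split.
  have e3 : C1 / s ^+ 2 * F3 z.1 <= C1 * (K3 * C3) / s.
    apply: le_trans (ler_wpM2l a3 F3l) _.
    by rewrite le_eqVlt; apply/orP; left; apply/eqP; field; rewrite gt_eqF.
  have e2 : C1 / s ^+ 4 * F2 z.1 <= C1 * (K2 * C2) / s.
    apply: le_trans (ler_wpM2l a2 F2l) _.
    have -> : C1 / s ^+ 4 * (K2 * (C2 * s)) = C1 * (K2 * C2) / s ^+ 3.
      by field; rewrite gt_eqF.
    rewrite ler_wpM2l// lef_pV2 ?posrE ?exprn_gt0//.
    by rewrite exprS ler_peMr ?(ltW s0)// exprn_ege1//; lra.
  have eD : D / s <= C / s by rewrite ler_wpM2r ?invr_ge0// ltW.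
  have eDE : D / s = C1 * (K3 * C3) / s + C1 * (K2 * C2) / s by rewrite -mulrDl.
  have p3 := mulr_ge0 a3 F30; have p2 := mulr_ge0 a2 F20.
  by apply/andP; split; rewrite !mulNr; lra.
rewrite (coupling_generatorD m
  (fun z : coupled_state n => rational_square (s ^+ 4) (corrected_gap m i z))
  (fun z => - (C1 / s ^+ 2) * F3 z.1 + - (C1 / s ^+ 4) * F2 z.1)).
rewrite (coupling_generatorD m (fun z : coupled_state n => - (C1 / s ^+ 2) * F3 z.1)
  (fun z => - (C1 / s ^+ 4) * F2 z.1)) !coupling_generatorZ.
rewrite (coupling_generator_fst m F3) (coupling_generator_fst m F2).
have L := phiL s z s0.
have L3 := ler_wpM2l a3 F3L; have L2 := ler_wpM2l a2 F2L.
rewrite ger0_norm in L3; last by rewrite divr_ge0 ?exprn_ge0 ?ltW.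
rewrite ger0_norm in L2; last by rewrite divr_ge0 ?ltW.
have eD : D / s ^+ 5 <= C / s ^+ 5 by rewrite ler_wpM2r// invr_ge0 exprn_ge0// ltW.
have eDE : D / s ^+ 5 = C1 / s ^+ 2 * (K3 * (C3 / s ^+ 3))
    + C1 / s ^+ 4 * (K2 * (C2 / s)) by rewrite /D; field; rewrite gt_eqF.
rewrite !mulrBr in L3 L2; rewrite !mulNr; lra.
Qed.
End TestFunction.

(** * Convergence in probability *)

Section Law.
Context {R : realType}.

Lemma measurable_coupled n (A : set (coupled_state n)) : measurable A.
Proof. by []. Qed.

Lemma measurable_fun_coupled n (f : coupled_state n -> R) : measurable_fun setT f.
Proof. by move=> _ Y mY; exact: measurable_coupled. Qed.

(** For large [t] the corrector, of size at most [n], is at most half of a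
displacement of order [sqrt t]. *)
Lemma rational_square_corrected_gap n (m : R) (i : 'I_n) (z : coupled_state n) eps t :
  0 < m -> 0 < eps -> 0 < t -> 4 * n%:R ^+ 2 <= eps * t ->
  eps <= `|(z.1 i - z.2 i)%:~R : R| ^+ 2 / t ->
  eps / (4 + eps) <= rational_square t (corrected_gap m i z).
Proof.
move=> m0 e0 t0 nt; rewrite ler_pdivlMr// => dt.
have := corrected_gap_dist i z m0; set h := corrected_gap m i z.
set d : R := (z.1 i - z.2 i)%:~R in dt *; set N : R := n%:R in nt * => hd.
have N0 : 0 <= N by rewrite ler0n.
have dN : 2 * N <= `|d| by rewrite -(@ler_pXn2r _ 2)// ?nnegrE ?mulr_ge0//; lra.
have hd2 : `|d| / 2 <= `|h| by have := ler_distD h d 0; rewrite !subr0 distrC; lra.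
have h2 : eps * t <= 4 * h ^+ 2.
  by rewrite -(real_normK (num_real h)); have := normr_ge0 d; nra.
rewrite /rational_square ler_pdivrMr; last lra.
rewrite mulrAC ler_pdivlMr; last by have := sqr_ge0 h; lra.
nra.
Qed.

(** The two-sided comparison of the test function with the bounded square turns the
bound on its mean at time [t] into Markov's inequality for the tail event; at
time [0] the displacement vanishes and only the corrector is left. *)
Lemma coupling_tail_bound n (m : R) (i : 'I_n) (y0 : config n)
    (p : R -> R.-pker (coupled_state n) ~> (coupled_state n)) (eps : R) :
  0 < m -> 0 < eps -> is_transition_semigroup p ->
  has_generator p (coupling_generator m) ->
  exists K : R, \forall t \near +oo,
    (p t (y0, y0) [set z : coupled_state n | (eps <= `|(z.1 i - z.2 i)%:~R : R| ^+ 2 / t)%R]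
      <= (K / fourth_root t)%:E)%E.
Proof.
move=> m0 e0 sp gp; have [C C1 testf] := gap_test_function i m0.
pose N : R := n%:R; have N0 : 0 <= N by rewrite ler0n.
pose k := eps / (4 + eps).
have k0 : 0 < k by rewrite divr_gt0//; lra.
exists ((N ^+ 2 + 3 * C) / k).
near=> t.
have t0 : 0 < t by near: t; exact: nbhs_pinfty_gt.
have tC : C ^+ 4 <= t by near: t; apply: nbhs_pinfty_ge; exact: num_real.
have tN : eps^-1 * (4 * N ^+ 2) <= t.
  by near: t; apply: nbhs_pinfty_ge; exact: num_real.
have nt : 4 * N ^+ 2 <= eps * t by rewrite -ler_pdivrMl.
set s := fourth_root t.
have s0 : 0 < s by exact: fourth_root_gt0.
have s4 : s ^+ 4 = t by apply: fourth_rootK; exact: ltW.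
have sC : C <= s by rewrite -(@ler_pXn2r _ 4)// ?nnegrE ?(ltW s0) ?s4//; lra.
have [f fP] := testf s sC.
set B := [set z | _].
have bphi z : 0 <= rational_square (s ^+ 4) (corrected_gap m i z) <= 1.
  by rewrite rational_square_ge0 ?rational_square_le1 ?exprn_gt0.
have bf : bounded_fun f.
apply: bounded_fun_of_le; exists (1 + C / s) => z; have [/andP[f1 f2] _] := fP z.
  have /andP[b1 b2] := bphi z.
  have cs : 0 <= C / s by rewrite divr_ge0 ?(ltW s0)//; lra.
  by rewrite ler_norml; apply/andP; split; lra.
have mf := measurable_fun_coupled f.
have := transition_op_generator_le sp gp mf bf (fun z => (fP z).2) (y0, y0) t0.
have bI : bounded_fun (\1_B : coupled_state n -> R).
  apply: bounded_fun_of_le; exists 1 => z; rewrite indicE.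
  by case: (_ \in _); rewrite ?normr1 ?normr0.
have mI := measurable_fun_coupled (\1_B : coupled_state n -> R).
have low : k * transition_op p t \1_B (y0, y0) <= transition_op p t f (y0, y0) + C / s.
  rewrite -transition_opZ// -transition_opDcst//.
  apply: transition_op_le;
    [exact: measurable_fun_coupled| |exact: measurable_fun_coupled| |].
  - apply: bounded_fun_of_le; exists k => z; rewrite indicE normrM gtr0_norm//.
    by case: (_ \in _); rewrite ?normr1 ?normr0 ?mulr1 ?mulr0// ltW.
  - have [M fM] := le_of_bounded_fun bf; apply: bounded_fun_of_le; exists (M + `|C / s|) => z.
    by rewrite (le_trans (ler_normD _ _))// lerD2r.
  move=> z; have [/andP[f1 f2] _] := fP z; have /andP[b1 b2] := bphi z.
  apply: (@le_trans _ _ (rational_square (s ^+ 4) (corrected_gap m i z))); last lra.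
  rewrite indicE; case: (boolP (z \in B)) => [|_]; last by rewrite mulr0.
  rewrite inE mulr1 s4 /B/= => zB.
  exact: rational_square_corrected_gap.
have init : f (y0, y0) <= N ^+ 2 / s.
  have [/andP[_ f2] _] := fP (y0, y0); apply: le_trans f2 _.
  have := corrected_gap_dist i (y0, y0) m0; rewrite /= subrr subr0.
  set h := corrected_gap _ _ _ => hN.
  have h2 : h ^+ 2 <= N ^+ 2.
    by rewrite -(real_normK (num_real h)) lerXn2r ?nnegrE.
  rewrite /rational_square s4; apply: ler_pM; rewrite ?sqr_ge0 ?invr_ge0 ?addr_ge0 ?sqr_ge0 ?(ltW t0)//.
  rewrite lef_pV2 ?posrE//; last by have := sqr_ge0 h; lra.
  have st : s <= t by rewrite -s4 exprS ler_peMr ?(ltW s0)// exprn_ege1//; lra.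
  by have := sqr_ge0 h; lra.
have -> : t * (C / s ^+ 5) = C / s by rewrite -s4; field; rewrite gt_eqF.
move=> up; rewrite -EFin_transition_op_indic; last exact: measurable_coupled.
rewrite lee_fin -mulrA mulrCA ler_pdivlMl//.
apply: le_trans low _.
have cs : 0 <= C / s by rewrite divr_ge0 ?(ltW s0)//; lra.
have -> : (N ^+ 2 + 3 * C) / s = N ^+ 2 / s + 3 * (C / s) by rewrite mulrDl mulrA.
lra.
Unshelve. all: by end_near.
Qed.

End Law.

Theorem theorem3p2 (R : realType) (d : measure_display) (T : measurableType d)
    (P : probability T R) (m : R) (n : nat)
    (X : R -> {RV P >-> coupled_state n}) (y0 : config n)
    (hm : 0 < m) (hn : (1 <= n)%N)
    (hX : markov_process_with_generator X (coupling_generator m))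
    (hX0 : {ae P, forall w, X 0 w = (y0, y0)}) (i : 'I_n) :
  cvg_in_probability P
    (fun (t : R) (w : T) =>
       `|((X t w).1 i - (X t w).2 i)%:~R : R| ^+ 2 / t) 0.
Proof.
move=> eps e0; have [p [sp gp mp]] := hX.
have [K tail] := coupling_tail_bound i y0 hm e0 sp gp.
apply: (@squeeze_cvge _ _ _ _ (cst 0%E) _ (fun t => (K / fourth_root t)%:E)).
- apply: filterS2 tail (nbhs_pinfty_ge (num_real (0 : R))) => t tail_t t0.
  apply/andP; split; first exact: measure_ge0.
  pose B := [set z : coupled_state n | eps <= `|(z.1 i - z.2 i)%:~R : R| ^+ 2 / t].
  have q0 w : 0 <= `|((X t w).1 i - (X t w).2 i)%:~R : R| ^+ 2 / t.
    by rewrite divr_ge0 ?exprn_ge0.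
  rewrite (_ : [set w | _] = X t @^-1` B); last first.
    by apply/seteqP; split=> w; rewrite /B /= subr0 (ger0_norm (q0 w)).
  by rewrite (markov_law mp hX0 t0) //; exact: measurable_coupled.
- exact: cvg_cst.
- apply: cvg_EFin; first by near=> t.
  rewrite /=; apply/cvgr0Pnorm_le => e e_gt0; near=> t.
  have t0 : 0 < t by near: t; exact: nbhs_pinfty_gt.
  have tK : (`|K| / e) ^+ 4 <= t.
    by near: t; apply: nbhs_pinfty_ge; exact: num_real.
  have s0 : 0 < fourth_root t by exact: fourth_root_gt0.
  rewrite normrM normfV (gtr0_norm s0) ler_pdivrMr// mulrC -ler_pdivrMr//.
  rewrite -(@ler_pXn2r _ 4)// ?nnegrE ?(ltW s0) ?divr_ge0 ?(ltW e_gt0)//.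
  by rewrite fourth_rootK// ltW.
Unshelve. all: by end_near.
Qed.
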